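(* Let $(G,i)$ be a rooted graph with $G$ connected. The following are equivalent: (a) $(G,i)$ allows the nullity pair $(1,2)$ with the SNIP; (b) $(G,i)$ contains $(\mathrm{Paw},i)$ or $(S(2,1,1),i)$ as a rooted minor; (c) $(G,i)$ is not a yam graph.
   Context: All matrices are real. For a simple graph $G$ on $[n]$, $\mathcal{S}(G)$ is the set of real symmetric $n\times n$ matrices whose off-diagonal $(j,k)$ entry is nonzero iff $\{j,k\}\in E(G)$ (diagonal free). $A(i)$ is $A$ with row and column $i$ deleted; the $i$-nullity pair of $A$ is $(\operatorname{null}(A),\operatorname{null}(A(i)))$. $A$ has the $i$-SNIP if $X=O$ is the only real symmetric $X$ with $A\circ X=O$, $I\circ X=O$ and $(AX)(i,:]=O$ ($AX$ with row $i$ deleted). $(G,i)$ allows $(k,\ell)$ with the SNIP if some $A\in\mathcal{S}(G)$ has $i$-nullity pair $(k,\ell)$ and the $i$-SNIP. $(G,i)$ is a rooted minor of $(H,i)$ if obtainable from $(H,i)$ by edge deletions, deletions of isolated non-root vertices, and edge contractions (new vertex is the root if the contracted edge contains the root). $(\mathrm{Paw},i)$: vertices $i,a,b,c$ with edges $ia, ab, ac, bc$, rooted at $i$. $(S(2,1,1),i)$: vertices $i,a,b,c,d$ with edges $ia, ab, bc, bd$, rooted at $i$. A generalized star is a tree with exactly one vertex of degree at least $3$ (its center). A yam graph is a connected rooted graph $(G,i)$ such that each component of $G-i$ is a generalized star or a path, and for each component of $G-i$ that is a generalized star, $i$ is adjacent only to its center (among the vertices of that component). *)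

(* Defs.v *)
From HB Require Import structures.
From mathcomp Require Import all_boot all_order all_algebra.
From mathcomp Require Import reals.

Set Implicit Arguments.
Unset Strict Implicit.
Unset Printing Implicit Defensive.

Import GRing.Theory.
Local Open Scope ring_scope.

Record sgraph (T : finType) := SGraph {
  adj :> rel T;
  adj_sym : symmetric adj;
  adj_irr : irreflexive adj
}.

Record rgraph := RGraph {
  vertex : finType;
  graph : sgraph vertex;
  root : vertex
}.

Section Graphs.
Variables (T : finType) (G : sgraph T).

Definition deg (x : T) : nat := #|[set y | adj G x y]|.

Definition connected_graph : Prop := forall x y : T, connect (adj G) x y.

Definition has_cycle : Prop := exists s : seq T, (2 < size s)%N /\ ucycle (adj G) s.

Definition is_tree : Prop := [/\ inhabited T, connected_graph & ~ has_cycle].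

(* Isomorphic to the path on m + 1 vertices; a single vertex is a path. *)
Definition is_path : Prop :=
  exists (m : nat) (f : 'I_m.+1 -> T), bijective f /\
    forall a b, adj G (f a) (f b) = (a.+1 == b :> nat) || (b.+1 == a :> nat).

Definition generalized_star : Prop := is_tree /\ exists! c : T, (3 <= deg c)%N.

Definition star_center (c : T) : Prop := generalized_star /\ (3 <= deg c)%N.

Definition component (x : T) : {set T} := [set y | connect (adj G) x y].

Section Induced.
Variable W : {set T}.

Definition induced_adj : rel {x : T | x \in W} :=
  fun x y => adj G (val x) (val y).

Lemma induced_sym : symmetric induced_adj.
Proof. by move=> x y; apply: adj_sym. Qed.

Lemma induced_irr : irreflexive induced_adj.
Proof. by move=> x; apply: adj_irr. Qed.

Definition induced : sgraph {x : T | x \in W} := SGraph induced_sym induced_irr.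
End Induced.

End Graphs.

Definition yam_graph (H : rgraph) : Prop :=
  let G := graph H in
  let i := root H in
  let Gi := induced G [set~ i] in
  connected_graph G /\
  forall x : {x | x \in [set~ i]},
    let C := component Gi x in
    let GC := induced Gi C in
    (generalized_star GC \/ is_path GC) /\
    (generalized_star GC ->
     forall z : {y | y \in C}, adj G i (val (val z)) -> star_center GC z).

(* The three minor operations are stated up to isomorphism: [op H G] means that
   G is isomorphic to a graph obtained from H by one operation, as witnessed by
   the map f. *)
Definition edge_deletion (H G : rgraph) : Prop :=
  exists (u v : vertex H) (f : vertex H -> vertex G),
    [/\ adj (graph H) u v, bijective f, f (root H) = root G &
        forall x y, adj (graph G) (f x) (f y) =
                    adj (graph H) x y && ([set x; y] != [set u; v])].

Definition isolated_vertex_deletion (H G : rgraph) : Prop :=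
  exists (v : vertex H) (f : vertex G -> vertex H),
    [/\ v != root H /\ (forall x, ~~ adj (graph H) v x),
        injective f /\ (forall x, (x \in codom f) = (x != v)),
        f (root G) = root H &
        forall x y, adj (graph G) x y = adj (graph H) (f x) (f y)].

(* f is the quotient map that identifies u and v; loops and parallel edges that
   arise are discarded. *)
Definition edge_contraction (H G : rgraph) : Prop :=
  exists (u v : vertex H) (f : vertex H -> vertex G),
    [/\ adj (graph H) u v,
        (forall p, exists x, f x = p) /\
        (forall x y, f x = f y <-> x = y \/ [set x; y] = [set u; v]),
        f (root H) = root G &
        forall p q, adj (graph G) p q <->
          p <> q /\ exists x y, [/\ f x = p, f y = q & adj (graph H) x y]].

Definition rooted_iso (H G : rgraph) : Prop :=
  exists f : vertex H -> vertex G,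
    [/\ bijective f, f (root H) = root G &
        forall x y, adj (graph G) (f x) (f y) = adj (graph H) x y].

Inductive rooted_minor (G : rgraph) : rgraph -> Prop :=
| minor_iso H : rooted_iso H G -> rooted_minor G H
| minor_edge_deletion H H' :
    edge_deletion H H' -> rooted_minor G H' -> rooted_minor G H
| minor_isolated_vertex_deletion H H' :
    isolated_vertex_deletion H H' -> rooted_minor G H' -> rooted_minor G H
| minor_edge_contraction H H' :
    edge_contraction H H' -> rooted_minor G H' -> rooted_minor G H.

Section EdgeList.
Variables (n : nat) (E : seq (nat * nat)).

Definition edge_list_adj : rel 'I_n := fun x y =>
  (x != y) && (((val x, val y) \in E) || ((val y, val x) \in E)).

Lemma edge_list_sym : symmetric edge_list_adj.
Proof. by move=> x y; rewrite /edge_list_adj eq_sym orbC. Qed.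

Lemma edge_list_irr : irreflexive edge_list_adj.
Proof. by move=> x; rewrite /edge_list_adj eqxx. Qed.

Definition edge_list_graph : sgraph 'I_n := SGraph edge_list_sym edge_list_irr.
End EdgeList.

(* i, a, b, c = 0, 1, 2, 3 *)
Definition Paw : rgraph :=
  RGraph (edge_list_graph 4 [:: (0, 1); (1, 2); (1, 3); (2, 3)]%N) ord0.

(* i, a, b, c, d = 0, 1, 2, 3, 4 *)
Definition S211 : rgraph :=
  RGraph (edge_list_graph 5 [:: (0, 1); (1, 2); (2, 3); (2, 4)]%N) ord0.

Section Matrices.
Variables (R : realType) (n : nat).

Definition in_S (G : sgraph 'I_n) (A : 'M[R]_n) : Prop :=
  A^T = A /\ forall j k, j != k -> (A j k != 0) = adj G j k.

(* The columns of [cokermx A] span {v | A v = 0}. *)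
Definition nullity (m : nat) (A : 'M[R]_m) : nat := \rank (cokermx A).

Definition nullity_pair (i : 'I_n) (A : 'M[R]_n) : nat * nat :=
  (nullity A, nullity (row' i (col' i A))).

Definition hadamard (A B : 'M[R]_n) : 'M[R]_n := map2_mx *%R A B.

Definition SNIP (i : 'I_n) (A : 'M[R]_n) : Prop :=
  forall X : 'M[R]_n, X^T = X ->
    hadamard A X = 0 -> hadamard 1%:M X = 0 -> row' i (A *m X) = 0 -> X = 0.

Definition allows_with_SNIP (G : sgraph 'I_n) (i : 'I_n) (k l : nat) : Prop :=
  exists A : 'M[R]_n, [/\ in_S G A, nullity_pair i A = (k, l) & SNIP i A].
End Matrices.

(* Main.v *)
(** All three conditions are equivalent to the following one, [obstructed]: the
    graph [G - i] has a cycle, or it has a vertex [b] of degree at least 3 and a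
    neighbor [j <> b] of [i] in the component of [b].

    Matrices.  If the nullity pair of [A] is (1,2), then [i] is a Parter vertex:
    column [i] of [A] is not orthogonal to the kernel of [A(i)], so this kernel
    has a vector that is nonzero at some neighbor [j] of [i].  For a Parter vertex
    the [i]-SNIP says that the kernel of [A(i)] has the strong Arnold property, so
    that it lives on the component of [j].  If [G] is not obstructed, a kernel
    vector vanishing at [j] then vanishes along every branch leaving [j],
    contradicting nullity 2.  Conversely, suitable matrices are obtained from graph
    Laplacians, whose kernels are known: by a rank-one downdate along an edge that
    is not a bridge, or by bordering at a branching vertex.

    Minors.  Obstruction lifts through each minor operation, and an obstructed
    connected graph has evident branch sets for the paw or for S(2,1,1). *)
From mathcomp Require Import all_boot all_order all_algebra.
From mathcomp Require Import reals boolp zify ring lra.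
Require Import Defs.

Set Implicit Arguments.
Unset Strict Implicit.
Unset Printing Implicit Defensive.

Section Connect.
Variables (T : finType) (e : rel T).

Lemma connect_ind (P : T -> Prop) x y :
  P x -> (forall a b, P a -> e a b -> P b) -> connect e x y -> P y.
Proof.
move=> + closedP /connectP[p + ->]; elim: p x => //= z p IHp x Px /andP[exz].
exact/IHp/(closedP _ _ Px).
Qed.

Lemma connect_exit (P : pred T) x y :
  connect e x y -> P x -> ~~ P y -> exists a b, [/\ P a, ~~ P b & e a b].
Proof.
move=> cxy Px nPy; apply: contrapT => noexit; move/negP: nPy; apply.
apply: (connect_ind (P := P) Px _ cxy) => a b Pa eab.
by apply: contrapT => /negP nPb; apply: noexit; exists a, b.
Qed.

Lemma connect_map (T' : finType) (e' : rel T') (f : T -> T') x y :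
  (forall a b, e a b -> connect e' (f a) (f b)) -> connect e x y ->
  connect e' (f x) (f y).
Proof.
pose P z := connect e' (f x) (f z); move=> f_e.
apply: (connect_ind (P := P)) => [|a b cxa /f_e]; first exact: connect0.
exact: connect_trans.
Qed.

Lemma connectC x y : symmetric e -> connect e x y = connect e y x.
Proof. by move/sym_connect_sym; apply. Qed.

Lemma connect_edge_eq z x y : symmetric e -> e x y -> connect e z x = connect e z y.
Proof.
move=> e_sym exy; apply: same_connect_r; last exact: connect1.
exact: sym_connect_sym.
Qed.

Lemma edge_neq x y : irreflexive e -> e x y -> x != y.
Proof. by move=> e_irr; apply: contraTneq => ->; rewrite e_irr. Qed.

End Connect.

Section InducedRel.
Variables (T : finType) (e : rel T).

Definition induced_rel (A : {pred T}) : rel T :=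
  fun x y => [&& x \in A, y \in A & e x y].

Definition avoid (j : T) : rel T := induced_rel (predC1 j).

Lemma avoidE j x y : avoid j x y = [&& x != j, y != j & e x y].
Proof. by []. Qed.

Lemma induced_rel_sym A : symmetric e -> symmetric (induced_rel A).
Proof. by move=> e_sym x y; rewrite /induced_rel e_sym andbCA. Qed.

Lemma induced_rel_irr A : irreflexive e -> irreflexive (induced_rel A).
Proof. by move=> e_irr x; rewrite /induced_rel e_irr !andbF. Qed.

Lemma induced_rel_sub A : subrel (induced_rel A) e.
Proof. by move=> x y /and3P[]. Qed.

Lemma connect_induced_sub A x y : connect (induced_rel A) x y -> connect e x y.
Proof. by apply: connect_sub => a b /induced_rel_sub/connect1. Qed.

Lemma connect_induced_mem A x y : connect (induced_rel A) x y -> x \in A -> y \in A.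
Proof.
move=> cxy Ax; apply: (connect_ind (P := fun z => z \in A) Ax _ cxy).
by move=> a b _ /and3P[].
Qed.

Lemma connect_avoid_neq j x y : connect (avoid j) x y -> x != j -> y != j.
Proof. exact: connect_induced_mem. Qed.

Lemma connect_avoidF j x : x != j -> connect (avoid j) x j = false.
Proof. by move=> nxj; apply/negP => /connect_avoid_neq/(_ nxj); rewrite eqxx. Qed.

Lemma connect_induced_component x y :
  connect e x y -> connect (induced_rel (connect e x)) x y.
Proof.
pose P z := connect e x z /\ connect (induced_rel (connect e x)) x z.
move=> cxy; suff [] : P y by [].
apply: (connect_ind _ _ cxy) => [|a b [cxa Cxa] eab]; first by split; apply: connect0.
have cxb := connect_trans cxa (connect1 eab); split=> //.
by apply: connect_trans Cxa (connect1 _); apply/and3P.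
Qed.

Lemma path_induced_rel (A : {pred T}) x p :
  x \in A -> path (induced_rel A) x p = path e x p && all (mem A) p.
Proof.
elim: p x => //= y p IHp x Ax; rewrite [induced_rel _ _ _]/induced_rel Ax /=.
by have [Ay|] := boolP (y \in A); rewrite ?andbF //= IHp // andbA.
Qed.

Lemma connect_last_edge x y :
  connect e x y -> x != y -> exists z, [/\ z != y, connect (avoid y) x z & e z y].
Proof.
move=> cxy nxy; pose P z := (z != y) && connect (avoid y) x z.
have [||a [b [/andP[nay cxa] nPb eab]]] := connect_exit (P := P) cxy.
- by rewrite /P nxy connect0.
- by rewrite /P eqxx.
exists a; split=> //; case: (eqVneq b y) eab => [<- //|nby] eab.
by move: nPb; rewrite /P nby (connect_trans cxa) // connect1 // avoidE nay nby.
Qed.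

End InducedRel.

Section Cycles.
Variables (T : finType) (e : rel T).

Definition cyclic : Prop := exists s : seq T, 2 < size s /\ ucycle e s.

Definition delete_edge (p q : T) : rel T :=
  fun x y => e x y && ~~ ((x == p) && (y == q) || (x == q) && (y == p)).

Definition has_nonbridge : Prop := exists x y, e x y /\ connect (delete_edge x y) x y.

Definition has_linked_neighbors : Prop :=
  exists b x y, [/\ x != y, e b x, e b y & connect (avoid e b) x y].

Lemma delete_edge_sym p q : symmetric e -> symmetric (delete_edge p q).
Proof.
move=> e_sym x y; rewrite /delete_edge e_sym; congr (_ && ~~ _).
by rewrite orbC; congr (_ || _); rewrite andbC.
Qed.

Lemma delete_edge_irr p q : irreflexive e -> irreflexive (delete_edge p q).
Proof. by move=> e_irr x; rewrite /delete_edge e_irr. Qed.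

Lemma delete_edge_sub p q : subrel (delete_edge p q) e.
Proof. by move=> x y /andP[]. Qed.

Hypotheses (e_sym : symmetric e) (e_irr : irreflexive e).

Lemma linked_neighbors_cyclic : has_linked_neighbors -> cyclic.
Proof.
move=> [b [x [y [nxy ebx eby /connectP[p xp Ey]]]]].
case/shortenP: xp Ey => q xq uq _ Ey {p}; exists (b :: x :: q); split.
  by case: q Ey {xq uq} => //= Ey; rewrite Ey eqxx in nxy.
have nxb : x != b by rewrite eq_sym (edge_neq e_irr ebx).
move: xq; rewrite path_induced_rel // => /andP[xq /allP nqb].
rewrite /ucycle /= ebx rcons_path xq -Ey e_sym eby /=.
have -> /= : b \notin x :: q; last exact: uq.
by rewrite inE negb_or eq_sym nxb; apply/negP => /nqb; rewrite !inE eqxx.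
Qed.

Lemma cyclic_nonbridge : cyclic -> has_nonbridge.
Proof.
move=> [[|x [|y p]] [] // p_gt0 /andP[/= /andP[exy]]].
rewrite rcons_path => /andP[yp elx] /and3P[nx ny up].
exists y, x; rewrite e_sym; split=> //.
apply: (@connect_trans _ _ (last y p)).
  apply/connectP; exists p => //; apply: (sub_in_path (P := predC1 x)) yp.
    by move=> a b; rewrite !inE /delete_edge => /negPf-> /negPf-> ->; rewrite andbF.
  by apply/allP => z zp; apply: contraNneq nx => <-.
apply: connect1; rewrite /delete_edge elx eqxx andbT /=.
move: nx; rewrite inE negb_or => /andP[/negPf-> _]; rewrite andbF orbF.
case: p p_gt0 ny {yp elx up} => //= z p _.
by apply: contraNneq => <-; apply: mem_last.
Qed.

Lemma nonbridge_linked_neighbors : has_nonbridge -> has_linked_neighbors.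
Proof.
move=> [x [y [exy cxy]]].
have [z [nzy cxz dzy]] := connect_last_edge cxy (edge_neq e_irr exy).
exists y, x, z; rewrite ![e y _]e_sym exy (delete_edge_sub dzy); split=> //.
  by apply: contraTneq dzy => <-; rewrite /delete_edge !eqxx andbF.
apply: connect_sub cxz => a b; rewrite avoidE => /and3P[nay nby /delete_edge_sub eab].
by rewrite connect1 // avoidE nay nby.
Qed.

Lemma cyclic_linkedP : cyclic <-> has_linked_neighbors.
Proof.
split; last exact: linked_neighbors_cyclic.
by move/cyclic_nonbridge/nonbridge_linked_neighbors.
Qed.

Lemma acyclic_branches (I : eqType) b (s : I -> T) : ~ cyclic ->
  injective s -> (forall a, e b (s a)) ->
  forall a c, connect (avoid e b) (s a) (s c) = (a == c).
Proof.
move=> acyclic s_inj bs a c; have [->|nac] := eqVneq; first exact: connect0.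
apply/negP => cac; apply/acyclic/cyclic_linkedP; exists b, (s a), (s c).
by rewrite (inj_eq s_inj).
Qed.

Lemma cyclic_nonbridgeP : cyclic <-> has_nonbridge.
Proof.
split; first exact: cyclic_nonbridge.
by move/nonbridge_linked_neighbors/linked_neighbors_cyclic.
Qed.

End Cycles.

Lemma cyclic_map (T T' : finType) (e : rel T) (e' : rel T') (g : T -> T') :
  injective g -> {homo g : x y / e x y >-> e' x y} -> cyclic e -> cyclic e'.
Proof.
move=> g_inj g_e [s [s_gt2 /andP[cycle_s uniq_s]]]; exists (map g s).
rewrite size_map /ucycle map_inj_uniq // uniq_s andbT; split=> //.
by rewrite cycle_map; apply: sub_cycle cycle_s.
Qed.

Definition unrooted_adj (H : rgraph) : rel (vertex H) := avoid (adj (graph H)) (root H).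

Lemma unrooted_adjE H x y : @unrooted_adj H x y =
  [&& x != root H, y != root H & adj (graph H) x y].
Proof. by []. Qed.

Lemma unrooted_sym H : symmetric (@unrooted_adj H).
Proof. exact/induced_rel_sym/adj_sym. Qed.

Lemma unrooted_irr H : irreflexive (@unrooted_adj H).
Proof. exact/induced_rel_irr/adj_irr. Qed.

Definition branching (H : rgraph) : Prop :=
  exists j b : vertex H,
    [/\ adj (graph H) (root H) j, j != b, connect (@unrooted_adj H) j b &
        2 < #|[set y | unrooted_adj b y]|].

Definition obstructed (H : rgraph) : Prop := cyclic (@unrooted_adj H) \/ branching H.

Lemma branching_legs (H : rgraph) (e := @unrooted_adj H) : ~ cyclic e -> branching H ->
  exists j b (s : 'I_3 -> vertex H),
    [/\ adj (graph H) (root H) j, connect (avoid e b) (s ord0) j, forall a, e b (s a) &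
        forall a c, connect (avoid e b) (s a) (s c) = (a == c)].
Proof.
have e_sym : symmetric e by apply: unrooted_sym.
move=> acyclic [j [b [ij njb cjb]]]; rewrite -/e => deg_b.
have [x [nxb cjx exb]] := connect_last_edge cjb njb; have ebx : e b x by rewrite e_sym.
have : 1 < #|[set y | e b y] :\ x| by move: deg_b; rewrite (cardsD1 x) inE ebx.
move=> /card_gt1P[y [z [/setD1P[nyx +] /setD1P[nzx +] nyz]]]; rewrite !inE => eby ebz.
pose s (a : 'I_3) := nth x [:: x; y; z] a; have s_inj : injective s.
  move=> a c /eqP; rewrite nth_uniq //= ?inE => [/eqP/val_inj //|].
  by rewrite negb_or eq_sym nyx eq_sym nzx nyz.
have bs a : e b (s a) by case: a => -[|[|[|[]]]].
exists j, b, s; split=> //; last by apply: acyclic_branches => //; apply: unrooted_irr.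
by rewrite connectC //; apply: induced_rel_sym.
Qed.

Lemma disjoints1r (T : finType) (A : {set T}) x : [disjoint A & [set x]] = (x \notin A).
Proof. by rewrite disjoint_sym disjoints1. Qed.

Lemma eq_set2 (T : finType) (x y u v : T) :
  ([set x; y] == [set u; v]) = (x == u) && (y == v) || (x == v) && (y == u).
Proof.
apply/eqP/idP => [E|/orP[]/andP[/eqP-> /eqP->] //]; last exact: setUC.
have: x \in [set u; v] by rewrite -E set21.
have: y \in [set u; v] by rewrite -E set22.
have: u \in [set x; y] by rewrite E set21.
have: v \in [set x; y] by rewrite E set22.
rewrite !inE [u == x]eq_sym [u == y]eq_sym [v == x]eq_sym [v == y]eq_sym.
by do 4!case: (_ == _).
Qed.

(** * Rooted minors from branch sets *)

(* The fibres of [phi] are the branch sets. *)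
Definition minor_model (Q H : rgraph) (phi : vertex H -> vertex Q) : Prop :=
  [/\ phi (root H) = root Q,
      forall p, exists x, phi x = p,
      forall x y, phi x = phi y ->
        connect [rel a b | adj (graph H) a b && (phi a == phi b)] x y &
      forall p q, adj (graph Q) p q ->
        exists x y, [/\ phi x = p, phi y = q & adj (graph H) x y]].

Section Contraction.
Variables (H : rgraph) (u v : vertex H).
Hypothesis adj_uv : adj (graph H) u v.

Lemma contraction_neq : u != v.
Proof. exact: (edge_neq (@adj_irr _ _)) adj_uv. Qed.

Definition contraction_vertex : finType := {w : vertex H | w != v}.

Definition contraction_map (w : vertex H) : contraction_vertex :=
  insubd (Sub u contraction_neq) w.

Lemma val_contraction_map w : val (contraction_map w) = if w != v then w else u.
Proof. exact: val_insubd. Qed.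

Lemma contraction_mapK (w : contraction_vertex) : contraction_map (val w) = w.
Proof. by apply: val_inj; rewrite val_contraction_map (valP w). Qed.

Lemma contraction_map_eq x y :
  contraction_map x = contraction_map y <-> x = y \/ [set x; y] = [set u; v].
Proof.
have nuv := contraction_neq; split=> [/(congr1 val)|].
  rewrite !val_contraction_map.
  case: (eqVneq x v) => [->|nx]; case: (eqVneq y v) => [->|ny] /= E; try by left.
    by right; rewrite E setUC.
  by right; rewrite E.
case=> [->//|/eqP]; rewrite eq_set2 => /orP[]/andP[/eqP-> /eqP->];
  by apply: val_inj; rewrite !val_contraction_map eqxx nuv.
Qed.

Definition contraction_adj : rel contraction_vertex := fun p q =>
  (p != q) && [exists x, exists y,
    [&& contraction_map x == p, contraction_map y == q & adj (graph H) x y]].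

Lemma contraction_sym : symmetric contraction_adj.
Proof.
move=> p q; rewrite /contraction_adj eq_sym; congr (_ && _).
apply/existsP/existsP => -[x /existsP[y /and3P[xp yq xy]]];
  by exists y; apply/existsP; exists x; rewrite xp yq adj_sym.
Qed.

Lemma contraction_irr : irreflexive contraction_adj.
Proof. by move=> p; rewrite /contraction_adj eqxx. Qed.

Definition contraction : rgraph :=
  RGraph (SGraph contraction_sym contraction_irr) (contraction_map (root H)).

Lemma contraction_map_adj x y :
  adj (graph H) x y -> contraction_map x != contraction_map y ->
  contraction_adj (contraction_map x) (contraction_map y).
Proof.
move=> xy nxy; rewrite /contraction_adj nxy; apply/existsP; exists x.
by apply/existsP; exists y; rewrite !eqxx.
Qed.

Lemma edge_contraction_contraction : edge_contraction H contraction.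
Proof.
exists u, v, contraction_map; split=> //.
  split=> [w|]; last exact: contraction_map_eq.
  by exists (val w); apply: contraction_mapK.
move=> p q; split=> [/andP[npq /existsP[x /existsP[y /and3P[/eqP xp /eqP yq xy]]]]|].
  by split; [apply/eqP | exists x, y].
move=> [/eqP npq [x [y [xp yq xy]]]]; rewrite -xp -yq in npq *.
exact: contraction_map_adj.
Qed.

Lemma contraction_model (Q : rgraph) (phi : vertex H -> vertex Q) :
  phi u = phi v -> minor_model phi ->
  minor_model (H := contraction) (fun w : contraction_vertex => phi (val w)).
Proof.
move=> phi_uv [phi_root phi_surj fibres edges].
have phi_contr w : phi (val (contraction_map w)) = phi w.
  by rewrite val_contraction_map; case: eqVneq => [->|].
split=> /= [|p|w z phi_wz|p q pq].
- by rewrite phi_contr.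
- by have [x <-] := phi_surj p; exists (contraction_map x); rewrite phi_contr.
- rewrite -[w]contraction_mapK -[z]contraction_mapK.
  apply: connect_map (fibres _ _ phi_wz) => a b /andP[ab phi_ab].
  have [->|nab] := eqVneq (contraction_map a) (contraction_map b).
    exact: connect0.
  by apply: connect1; rewrite /= !phi_contr phi_ab andbT; apply: contraction_map_adj.
- have [x [y [xp yq xy]]] := edges p q pq.
  exists (contraction_map x), (contraction_map y); rewrite !phi_contr; split=> //.
  apply: contraction_map_adj => //; apply: contraTneq pq => /(congr1 (phi \o val)) /=.
  by rewrite !phi_contr xp yq => ->; rewrite adj_irr.
Qed.

End Contraction.

Definition edge_removal (H : rgraph) (u v : vertex H) : rgraph :=
  RGraph (SGraph (delete_edge_sym u v (@adj_sym _ (graph H)))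
                 (delete_edge_irr u v (@adj_irr _ (graph H)))) (root H).

Lemma edge_deletion_removal (H : rgraph) (u v : vertex H) :
  adj (graph H) u v -> edge_deletion H (edge_removal u v).
Proof.
move=> uv; exists u, v, id; split=> // [|x y]; first by exists id.
by rewrite eq_set2.
Qed.

Lemma bijective_model_iso (Q H : rgraph) (phi : vertex H -> vertex Q) :
  injective phi -> minor_model phi ->
  {homo phi : x y / adj (graph H) x y >-> adj (graph Q) x y} -> rooted_iso H Q.
Proof.
move=> phi_inj [phi_root phi_surj _ edges] phi_adj; exists phi; split=> // [|x y].
  have [r rK] := choice phi_surj; exists r => // x; exact/phi_inj/rK.
apply/idP/idP => [pq|]; last exact: phi_adj.
by have [x' [y' [/phi_inj-> /phi_inj->]]] := edges _ _ pq.
Qed.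

Lemma injective_model_minor (Q H : rgraph) (phi : vertex H -> vertex Q) :
  injective phi -> minor_model phi -> rooted_minor Q H.
Proof.
have [m] := ubnP #|[set xy | adj (graph H) xy.1 xy.2 &&
                            ~~ adj (graph Q) (phi xy.1) (phi xy.2)]|.
elim: m H phi => // m IHm H phi card_extra phi_inj model.
have [phi_root phi_surj _ edges] := model.
have [hom|] := pselect {homo phi : x y / adj (graph H) x y >-> adj (graph Q) x y}.
  exact: minor_iso (bijective_model_iso phi_inj model hom).
move=> /existsNP[u /existsNP[v /not_implyP[uv /negP nuv]]].
apply: minor_edge_deletion (edge_deletion_removal uv) _.
apply: (IHm (edge_removal u v) phi) => //.
  move: card_extra; rewrite ltnS; apply: leq_trans; apply: proper_card.
  apply/properP; split.
    by apply/subsetP => -[x y]; rewrite !inE /= => /andP[/delete_edge_sub-> ->].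
  by exists (u, v); rewrite !inE /= ?uv ?nuv // /delete_edge !eqxx andbF.
split=> // [x y /phi_inj->|p q pq]; first exact: connect0.
have [x [y [xp yq xy]]] := edges p q pq; exists x, y; split=> //=.
rewrite /delete_edge xy /=; apply: contraNN nuv.
by case/orP=> /andP[/eqP<- /eqP<-]; rewrite xp yq ?[adj _ q p]adj_sym.
Qed.

Lemma minor_model_minor (Q H : rgraph) (phi : vertex H -> vertex Q) :
  minor_model phi -> rooted_minor Q H.
Proof.
have [m] := ubnP #|vertex H|.
elim: m H phi => // m IHm H phi card_H model; have [_ _ fibres _] := model.
have [phi_inj|] := pselect (injective phi); first exact: injective_model_minor model.
move=> /existsNP[x /existsNP[y /not_implyP[phi_xy /eqP nxy]]].
have [u [_ _ /andP[uy /eqP phi_uy]]] := connect_last_edge (fibres x y phi_xy) nxy.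
apply: minor_edge_contraction (edge_contraction_contraction uy) _.
apply: IHm (contraction_model uy phi_uy model).
rewrite card_sig -[#|_|]/#|predC1 y| cardC1 -ltnS prednK //.
by apply/card_gt0P; exists y.
Qed.

Section ConnectedSet.
Variables (T : finType) (e : rel T).

Definition connected_set (A : {set T}) : Prop :=
  A != set0 /\ {in A &, forall x y, connect (induced_rel e A) x y}.

Lemma connected_set1 x : connected_set [set x].
Proof.
split=> [|y z]; last by rewrite !inE => /eqP-> /eqP->; apply: connect0.
by apply/set0Pn; exists x; rewrite set11.
Qed.

Hypothesis e_sym : symmetric e.

Lemma connected_set_from x (A : {set T}) :
  x \in A -> {in A, forall y, connect (induced_rel e A) x y} -> connected_set A.
Proof.
move=> Ax conn_x; split=> [|y z Ay Az]; first by apply/set0Pn; exists x.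
apply: connect_trans (conn_x z Az); rewrite connectC; first exact: conn_x.
exact: induced_rel_sym.
Qed.

Lemma connected_set_component (e' : rel T) x :
  subrel e' e -> connected_set [set y | connect e' x y].
Proof.
move=> sub; apply: (connected_set_from (x := x)) => [|y]; rewrite inE ?connect0 //.
move/connect_induced_component; apply: connect_sub => a b /and3P[xa xb /sub ab].
by apply: connect1; apply/and3P; split; rewrite ?inE.
Qed.

Lemma connected_set_path x p : path e x p -> connected_set [set y in x :: p].
Proof.
move=> xp; apply: (connected_set_from (x := x)) => [|y]; rewrite inE ?mem_head //.
move=> yp; apply: path_connect yp; rewrite path_induced_rel ?inE ?eqxx // xp /=.
by apply/allP => z zp; rewrite /= !inE zp orbT.
Qed.

Lemma connected_setU1 (A : {set T}) y z :
  connected_set A -> y \in A -> e y z -> connected_set (z |: A).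
Proof.
move=> [_ conn_A] Ay yz; apply: (connected_set_from (x := y)) => [|x].
  exact: setU1r.
case/setU1P=> [->|Ax]; first by rewrite connect1 // /induced_rel setU1r // setU11.
apply: connect_sub (conn_A y x Ay Ax) => a b /and3P[Aa Ab ab].
by rewrite connect1 // /induced_rel !setU1r.
Qed.

End ConnectedSet.

Section BranchSets.
Variables Q H : rgraph.

Definition branch_sets (B : vertex Q -> {set vertex H}) : Prop :=
  [/\ root H \in B (root Q),
      forall p q x, x \in B p -> x \in B q -> p = q,
      forall p, connected_set (adj (graph H)) (B p) &
      forall p q, adj (graph Q) p q ->
        exists x y, [/\ x \in B p, y \in B q & adj (graph H) x y]].

Lemma spanning_branch_sets_model (B : vertex Q -> {set vertex H}) :
  branch_sets B -> (forall x, exists p, x \in B p) ->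
  exists phi : vertex H -> vertex Q, minor_model phi.
Proof.
move=> [B_root B_disj B_conn edges] /choice[phi phiP]; exists phi.
have phiE p x : x \in B p -> phi x = p by apply: B_disj.
split=> [|p|x y phi_xy|p q /edges[x [y [/phiE xp /phiE yq xy]]]].
- exact: phiE.
- by have [/set0Pn[x /phiE]] := B_conn p; exists x.
- have [_ conn_B] := B_conn (phi y).
  have phi_x : x \in B (phi y) by rewrite -phi_xy.
  apply: connect_sub (conn_B x y phi_x (phiP y)) => a b.
  case/and3P=> /phiE phi_a /phiE phi_b ab.
  by rewrite connect1 //= ab phi_a phi_b eqxx.
- by exists x, y.
Qed.

Lemma branch_sets_absorb (B : vertex Q -> {set vertex H}) q y z :
  branch_sets B -> (forall p, z \notin B p) -> y \in B q -> adj (graph H) y z ->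
  branch_sets (fun p => if p == q then z |: B p else B p).
Proof.
move=> [B_root B_disj B_conn edges] nBz By yz.
have B_sub p x : x \in B p -> x \in (if p == q then z |: B p else B p).
  by case: eqP => // _; apply: setU1r.
have B_old p x : x != z -> x \in (if p == q then z |: B p else B p) -> x \in B p.
  by move/negPf=> nxz; case: eqP => // _; rewrite !inE nxz.
have B_z p : z \in (if p == q then z |: B p else B p) -> p = q.
  by case: eqP => // _; rewrite (negPf (nBz p)).
split=> [|p p' x|p|p p' /edges[a [b [/B_sub Ba /B_sub Bb ab]]]].
- exact: B_sub.
- have [-> /B_z-> /B_z-> //|nxz] := eqVneq x z.
  by move=> /(B_old _ _ nxz) + /(B_old _ _ nxz); apply: B_disj.
- case: eqP => [->|_]; last exact: B_conn.
  exact: (connected_setU1 (@adj_sym _ _) (B_conn q) By yz).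
- by exists a, b.
Qed.

(* In a connected graph, the vertices outside the branch sets are absorbed one by
   one. *)
Lemma branch_sets_minor (B : vertex Q -> {set vertex H}) :
  connected_graph (graph H) -> branch_sets B -> rooted_minor Q H.
Proof.
move=> H_conn; have [m] := ubnP #|[set x | [forall p, x \notin B p]]|.
elim: m B => // m IHm B card_rest branchB.
have [cover|] := pselect (forall x, exists p, x \in B p).
  by have [phi] := spanning_branch_sets_model branchB cover; apply: minor_model_minor.
move=> /existsNP[x nBx]; have [B_root _ _ _] := branchB.
have [||y [z [/existsP[q By] nBz yz]]] :=
  connect_exit (P := fun w => [exists p, w \in B p]) (H_conn (root H) x).
- by apply/existsP; exists (root Q).
- by apply/existsP.
have {}nBz : forall p, z \notin B p by move: nBz; rewrite negb_exists => /forallP.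
apply: IHm (branch_sets_absorb branchB nBz By yz).
move: card_rest; rewrite ltnS; apply: leq_trans; apply: proper_card.
apply/properP; split; last first.
  exists z; rewrite inE; first exact/forallP.
  by rewrite negb_forall; apply/existsP; exists q; rewrite eqxx setU11.
apply/subsetP => w; rewrite !inE => /forallP nBw; apply/forallP => p.
by have := nBw p; case: eqP => // _; rewrite !inE negb_or => /andP[].
Qed.

End BranchSets.

Lemma edge_list_minor n E (H : rgraph) (B : seq {set vertex H}) :
  connected_graph (graph H) -> size B = n.+1 ->
  pairwise (fun A A' : {set vertex H} => [disjoint A & A']) B ->
  root H \in nth set0 B 0 ->
  (forall A, A \in B -> connected_set (adj (graph H)) A) ->
  (forall p q, (p, q) \in E -> exists x y,
     [/\ x \in nth set0 B p, y \in nth set0 B q & adj (graph H) x y]) ->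
  rooted_minor (RGraph (edge_list_graph n.+1 E) ord0) H.
Proof.
move=> H_conn size_B /(pairwiseP set0) disj B_root B_conn edges.
apply: (@branch_sets_minor (RGraph _ _) H (fun p : 'I_n.+1 => nth set0 B p)) => //.
have disj_lt (p q : 'I_n.+1) x : p < q -> x \in nth set0 B p -> x \notin nth set0 B q.
  by move=> lt_pq Bp; rewrite (disjointFr (disj _ _ _ _ lt_pq) Bp) // inE size_B.
split=> // [p q x Bp Bq|p|p q].
- case: (ltngtP p q) => [/disj_lt/(_ Bp)|/disj_lt/(_ Bq)|/val_inj //].
    by rewrite Bq.
  by rewrite Bp.
- by apply: B_conn; rewrite mem_nth // size_B.
- case/andP=> _ /orP[/edges //|/edges[x [y [Bx By xy]]]].
  by exists y, x; rewrite adj_sym.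
Qed.

Section ObstructedMinor.
Variable H : rgraph.
Hypothesis H_conn : connected_graph (graph H).
Let i : vertex H := root H.
Let e : rel (vertex H) := @unrooted_adj H.

Let e_irr : irreflexive e := @unrooted_irr H.
Let e_adj : subrel e (adj (graph H)) := @induced_rel_sub _ _ _.

Lemma attached_cycle : cyclic e -> exists a b c p u,
  let s := [:: a, b, c & p] in
  [/\ ucycle e s, i \notin s,
      connect (induced_rel (adj (graph H)) (predC (mem s))) i u &
      adj (graph H) u a].
Proof.
move=> [s [s_gt2 ucycle_s]]; have [cycle_s _] := andP ucycle_s.
have nis : i \notin s.
  by apply/negP => /(next_cycle cycle_s); rewrite /e unrooted_adjE eqxx.
pose off := connect (induced_rel (adj (graph H)) (predC (mem s))) i.
have off_mem w : off w -> w \notin s by move/connect_induced_mem; apply.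
have head_s : head i s \in s by case: (s) s_gt2 => // x p _; apply: mem_head.
have [||u [v [off_u noff_v uv]]] := connect_exit (P := off) (H_conn i (head i s)).
- exact: connect0.
- by apply: contraL head_s; apply: off_mem.
have vs : v \in s.
  apply: contraNT noff_v => nvs; apply: (connect_trans off_u (connect1 _)).
  by rewrite /induced_rel !inE nvs off_mem.
have [k s' rot_s] := rot_to vs.
have: ucycle e (rot k s) by rewrite rot_ucycle.
have: i \notin rot k s by rewrite mem_rot.
have: connect (induced_rel (adj (graph H)) (predC (mem (rot k s)))) i u.
  by rewrite (eq_connect (e' := induced_rel (adj (graph H)) (predC (mem s)))) // => a b;
    rewrite /induced_rel !inE !mem_rot.
move: s_gt2; rewrite -(size_rot k s) rot_s; case: s' {rot_s} => [|b [|c p]] //= _.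
by move=> *; exists v, b, c, p, u.
Qed.

Lemma cyclic_Paw_minor : cyclic e -> rooted_minor Paw H.
Proof.
move=> /attached_cycle[a [b [c [p [u [ucycle_s nis off_u ua]]]]]].
set s := [:: a, b, c & p] in ucycle_s nis off_u.
have /andP[/= /and3P[eab ebc +] /and4P[nabcp nbcp _ _]] := ucycle_s.
rewrite rcons_path => /andP[ecp ela].
pose R := induced_rel (adj (graph H)) (predC (mem s)).
have R_off w : connect R i w -> w \notin s by move/connect_induced_mem; apply.
pose off := [set w | connect R i w].
apply: (edge_list_minor (B := [:: off; [set a]; [set b]; [set z in c :: p]])) => //.
- have s_off w : w \in s -> w \notin off.
    by move=> ws; rewrite inE; apply: contraL ws; apply: R_off.
  move: nabcp nbcp; rewrite /= !disjoints1r !disjoints1 !s_off !inE ?eqxx ?orbT //=.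
  rewrite !negb_or eq_sym => /and3P[-> -> ->] /andP[-> ->]; rewrite !andbT.
  rewrite disjoint_subset; apply/subsetP => w; rewrite inE => /R_off.
  by apply: contraNN => wcp; rewrite !inE in wcp *; rewrite wcp !orbT.
- by rewrite /= inE connect0.
- move=> A; rewrite !inE => /or4P[]/eqP->; try exact: connected_set1.
    by apply: (connected_set_component (@adj_sym _ (graph H))); apply: induced_rel_sub.
  by apply: (connected_set_path (@adj_sym _ (graph H))); apply: sub_path ecp.
- move=> q r; rewrite !inE => /or4P[]/eqP[-> ->] /=.
  + by exists u, a; rewrite !inE eqxx.
  + by exists a, b; rewrite !inE eqxx e_adj.
  + by exists a, (last c p); rewrite set11 inE mem_last adj_sym e_adj.
  + by exists b, c; rewrite !inE !eqxx e_adj.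
Qed.

Lemma branching_S211_minor : ~ cyclic e -> branching H -> rooted_minor S211 H.
Proof.
move=> acyclic /(branching_legs acyclic)[j [b [s [ij csj bs legs]]]].
have nsb a : s a != b by rewrite eq_sym; apply: edge_neq (bs a).
have nsi a : s a != i by have /and3P[] := bs a.
have adj_bs a : adj (graph H) b (s a) by apply/e_adj.
have nbi : b != i by have /and3P[] := bs ord0.
pose A := [set w | connect (avoid e b) (s ord0) w].
have neq a c : a != c -> s a != s c.
  by move=> nac; apply: contraNneq nac => sac; rewrite -legs sac connect0.
have nA a : a != ord0 -> s a \notin A by rewrite inE legs eq_sym.
have nAi : i \notin A.
  by rewrite inE; apply/negP => /connect_induced_sub; rewrite connect_avoidF.
have nAb : b \notin A by rewrite inE connect_avoidF.
pose c := s (inord 1); pose d := s (inord 2).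
apply: (edge_list_minor (B := [:: [set i]; A; [set b]; [set c]; [set d]])) => //.
- rewrite /= !disjoints1r !disjoints1 nAi nAb !in_set1 nbi !nsi !nsb.
  by rewrite !nA ?neq // -val_eqE /= !inordK.
- by rewrite /= inE.
- move=> A'; rewrite !inE => /or4P[|||/orP[]]/eqP->; try exact: connected_set1.
  apply: (connected_set_component (@adj_sym _ (graph H))) => x y.
  by move/induced_rel_sub/e_adj.
- move=> q r; rewrite !inE => /or4P[]/eqP[-> ->] /=.
  + by exists i, j; rewrite !inE eqxx csj.
  + by exists (s ord0), b; rewrite !inE eqxx connect0 adj_sym.
  + by exists b, c; rewrite !inE !eqxx adj_bs.
  + by exists b, d; rewrite !inE !eqxx adj_bs.
Qed.

Lemma obstructed_minor : obstructed H -> rooted_minor Paw H \/ rooted_minor S211 H.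
Proof.
have [cyc _|acyclic] := pselect (cyclic e); first by left; apply: cyclic_Paw_minor.
by case=> [//|branch]; right; apply: branching_S211_minor.
Qed.

End ObstructedMinor.

(** * Obstructions lift through minor operations *)

Lemma obstructed_map (H H' : rgraph) (g : vertex H' -> vertex H) :
  injective g -> g (root H') = root H ->
  {homo g : x y / adj (graph H') x y >-> adj (graph H) x y} ->
  obstructed H' -> obstructed H.
Proof.
move=> g_inj g_root g_adj.
have g_e x y : unrooted_adj x y -> unrooted_adj (g x) (g y).
  by rewrite !unrooted_adjE -g_root !(inj_eq g_inj) => /and3P[-> -> /g_adj].
case=> [/(cyclic_map g_inj g_e)|[j [b [ij njb cjb deg_b]]]]; first by left.
right; exists (g j), (g b); split.
- by rewrite -g_root g_adj.
- by rewrite (inj_eq g_inj).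
- by apply: connect_map cjb => x y /g_e; apply: connect1.
apply: leq_trans deg_b _; rewrite -(card_imset _ g_inj); apply/subset_leq_card/subsetP.
by move=> _ /imsetP[y + ->]; rewrite !inE => /g_e.
Qed.

Section LiftContraction.
Variables (H H' : rgraph) (u v : vertex H) (f : vertex H -> vertex H').
Hypotheses (adj_uv : adj (graph H) u v)
  (f_eq : forall x y, f x = f y <-> x = y \/ [set x; y] = [set u; v])
  (f_root : f (root H) = root H')
  (f_adj : forall p q, adj (graph H') p q <->
     p <> q /\ exists x y, [/\ f x = p, f y = q & adj (graph H) x y]).

Let e : rel (vertex H) := @unrooted_adj H.
Let e' : rel (vertex H') := @unrooted_adj H'.

Let e_sym : symmetric e := @unrooted_sym H.
Let e_irr : irreflexive e := @unrooted_irr H.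
Let e'_irr : irreflexive e' := @unrooted_irr H'.

Lemma contracted_pair x y : f x = f y -> x != y -> [set x; y] = [set u; v].
Proof. by move=> /f_eq[->|//]; rewrite eqxx. Qed.

Lemma contracted_pair_adj x y : f x = f y -> x != y -> adj (graph H) x y.
Proof.
move=> fxy nxy; have /eqP := contracted_pair fxy nxy; rewrite eq_set2.
by case/orP=> /andP[/eqP-> /eqP->] //; rewrite adj_sym.
Qed.

Lemma fibre_edge x y : f x = f y -> x != y -> f x != root H' -> e x y.
Proof.
move=> fxy nxy nfx; rewrite /e unrooted_adjE contracted_pair_adj // andbT.
apply/andP; split; apply: contraNneq nfx => E; first by rewrite E f_root.
by rewrite fxy E f_root.
Qed.

Lemma lift_edge p q : e' p q -> exists x y, [/\ f x = p, f y = q & e x y].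
Proof.
move=> /and3P[np nq /f_adj[_ [x [y [xp yq xy]]]]]; exists x, y; split=> //.
rewrite /e unrooted_adjE xy andbT; apply/andP; split.
  by apply: contraNneq np => xi; rewrite -xp xi f_root.
by apply: contraNneq nq => yi; rewrite -yq yi f_root.
Qed.

Lemma lift_connect (R : rel (vertex H)) (R' : rel (vertex H')) x y :
  (forall p q, R' p q -> exists a b, [/\ f a = p, f b = q & R a b]) ->
  (forall a b, f a = f b -> a != b -> f a != root H' -> R a b) ->
  (forall p q, R' p q -> q != root H') ->
  f x != root H' -> connect R' (f x) (f y) -> connect R x y.
Proof.
move=> liftR fibR R'root nfx cxy.
have fibC a b : f a = f b -> f a != root H' -> connect R a b.
  move=> fab nfa; have [->|nab] := eqVneq a b; first exact: connect0.
  exact/connect1/fibR.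
pose P p := p != root H' /\ forall z, f z = p -> connect R x z.
suff [_ ->//] : P (f y).
apply: (connect_ind (P := P) _ _ cxy) => [|p q [np cxp] R'pq].
  by split=> // z fz; apply: fibC.
split=> [|z fz]; first exact: R'root R'pq.
have [a [b [ap bq Rab]]] := liftR p q R'pq.
apply: connect_trans (cxp _ ap) (connect_trans (connect1 Rab) _).
by apply: fibC; rewrite bq ?fz //; apply: R'root R'pq.
Qed.

Lemma lift_cyclic : cyclic e' -> cyclic e.
Proof.
have e'_sym : symmetric e' by apply: unrooted_sym.
move=> /(cyclic_nonbridgeP e'_sym e'_irr)[p [q [pq cpq]]]; apply/cyclic_nonbridgeP => //.
have [x [y [xp yq xy]]] := lift_edge pq; have npq := edge_neq e'_irr pq.
exists x, y; split=> //; rewrite -{}xp -{}yq in pq cpq npq *.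
apply: lift_connect cpq.
- move=> c d /andP[/lift_edge[a [b [<- <- ab]]] nab]; exists a, b; split=> //.
  rewrite /delete_edge ab; apply: contraNN nab.
  by case/orP=> /andP[/eqP-> /eqP->]; rewrite !eqxx ?orbT.
- move=> a b fab nab nfa; rewrite /delete_edge fibre_edge //=.
  by apply: contraNN npq => /orP[]/andP[/eqP<- /eqP<-]; rewrite fab.
- by move=> c d /andP[/and3P[]].
- by case/and3P: pq.
Qed.

Lemma lift_degree b' : 2 < #|[set y | e' b' y]| ->
  exists2 b, f b = b' & 2 < #|[set y | e b y]|.
Proof.
pose N p := [set y | e p y]; move=> deg_b'.
have [y'] : exists y', y' \in [set y | e' b' y].
  by apply/card_gt0P; apply: ltn_trans deg_b'.
rewrite inE => b'y'; have [x [_ [xb _ _]]] := lift_edge b'y'.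
have nb' : b' != root H' by case/and3P: b'y'.
have N_lift z' : e' b' z' -> exists a z, [/\ f a = b', f z = z', f z != b' & e a z].
  move=> b'z'; have [a [z [fa fz az]]] := lift_edge b'z'; exists a, z; split=> //.
  by rewrite fz eq_sym (edge_neq e'_irr b'z').
have [single|] := pselect (forall a, f a = b' -> a = x).
  exists x => //; apply: leq_trans deg_b' (leq_trans _ (leq_imset_card f (mem (N x)))).
  apply/subset_leq_card/subsetP => z'; rewrite inE.
  move=> /N_lift[a [z [/single-> <- _ xz]]].
  by apply: imset_f; rewrite inE.
move=> /existsNP[y /not_implyP[fy /eqP nyx]].
have xy : e x y by apply: fibre_edge; rewrite ?xb // eq_sym.
have yx : e y x by rewrite e_sym.
have pair a : f a = b' -> a = x \/ a = y.
  move=> fa; have [->|nax] := eqVneq a x; [by left | right].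
  have : a \in [set x; y].
    rewrite [[set x; y]]setUC (contracted_pair _ nyx) ?xb //.
    by rewrite -(contracted_pair _ nax) ?xb // set21.
  by rewrite !inE (negPf nax) => /eqP.
have card_Nb' : #|[set y | e' b' y]| <= #|N x :\ y| + #|N y :\ x|.
  apply: leq_trans (leq_add (leq_imset_card f _) (leq_imset_card f _)).
  apply: leq_trans (leq_card_setU _ _); apply/subset_leq_card/subsetP => z'.
  rewrite inE => /N_lift[a [z [fa <- nz az]]]; rewrite inE.
  have [nzx nzy] : z != x /\ z != y by split; apply: contraNneq nz => ->; apply/eqP.
  apply/orP; case: (pair a fa) az => -> az; [left | right].
    by rewrite imset_f // !inE nzy.
  by rewrite imset_f // !inE nzx.
have := cardsD1 y (N x); have := cardsD1 x (N y); rewrite !inE xy yx.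
have [deg_x _ _|] := ltnP 2 #|N x|; first by exists x.
by exists y => //; move: deg_b' card_Nb'; rewrite -/(N y); lia.
Qed.

Lemma lift_root_neighbor j' b :
  adj (graph H') (root H') j' -> j' != f b -> connect e' j' (f b) ->
  exists j, [/\ adj (graph H) (root H) j, j != b & connect e j b].
Proof.
move=> ij' njb cjb; have nj' : j' != root H'.
  by rewrite eq_sym (edge_neq (@adj_irr _ _) ij').
have [_ [x [y [xi yj xy]]]] := (f_adj _ _).1 ij'.
have neq_b z : f z != f b -> z != b by apply: contraNneq => ->.
have nyi : y != root H by apply: contraNneq nj' => yi; rewrite -yj yi f_root.
have cyb : connect e y b.
  rewrite -yj in nj' cjb; apply: lift_connect cjb => // [||p q /and3P[] //].
    exact: lift_edge.
  exact: fibre_edge.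
have [xr|nx] := eqVneq x (root H).
  by exists y; rewrite -xr; split=> //; apply: neq_b; rewrite yj.
exists x; split.
- by apply: contracted_pair_adj; rewrite ?f_root // eq_sym.
- by apply: neq_b; rewrite xi eq_sym; apply: connect_avoid_neq cjb nj'.
- by apply: connect_trans cyb; rewrite connect1 // /e unrooted_adjE nx nyi.
Qed.

Lemma lift_obstructed : obstructed H' -> obstructed H.
Proof.
case=> [/lift_cyclic|[j' [b' [ij' njb cjb /lift_degree[b fb deg_b]]]]]; first by left.
rewrite -{}fb in njb cjb; have [j [ij njb' cjb']] := lift_root_neighbor ij' njb cjb.
by right; exists j, b.
Qed.

End LiftContraction.

Lemma minor_obstructed (Q H : rgraph) :
  obstructed Q -> rooted_minor Q H -> obstructed H.
Proof.
move=> obsQ; elim=> {H} [H|H H'|H H'|H H'].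
- move=> [f [[g fK gK] f_root f_adj]].
  apply: (obstructed_map (can_inj gK)) obsQ; first by rewrite -f_root fK.
  by move=> x y xy; rewrite -f_adj !gK.
- move=> [u [v [f [_ [g fK gK] f_root f_adj]]]] _.
  apply: (obstructed_map (can_inj gK)); first by rewrite -f_root fK.
  by move=> x y; rewrite -{1}[x]gK -{1}[y]gK f_adj => /andP[].
- move=> [v [f [_ [f_inj _] f_root f_adj]]] _.
  by apply: (obstructed_map f_inj) => // x y; rewrite f_adj.
- move=> [u [v [f [uv [_ f_eq] f_root f_adj]]]] _.
  exact: lift_obstructed uv f_eq f_root f_adj.
Qed.

Lemma edge_list_adj_inord n E p q : p < n.+1 -> q < n.+1 ->
  @edge_list_adj n.+1 E (inord p) (inord q) =
  (p != q) && (((p, q) \in E) || ((q, p) \in E)).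
Proof. by move=> pn qn; rewrite /edge_list_adj -val_eqE /= !inordK. Qed.

Lemma edge_list_unrooted_adj n E p q : p < n.+1 -> q < n.+1 ->
  @unrooted_adj (RGraph (edge_list_graph n.+1 E) ord0) (inord p) (inord q) =
  [&& p != 0, q != 0, p != q & ((p, q) \in E) || ((q, p) \in E)].
Proof.
by move=> pn qn; rewrite unrooted_adjE /= edge_list_adj_inord // -!val_eqE /= !inordK.
Qed.

Lemma Paw_obstructed : obstructed Paw.
Proof.
left; exists [:: inord 1; inord 2; inord 3]; split=> //.
by rewrite /ucycle /= !edge_list_unrooted_adj //= !inE -!val_eqE /= !inordK.
Qed.

Lemma S211_obstructed : obstructed S211.
Proof.
right; exists (inord 1), (inord 2); split.
- have -> : root S211 = inord 0 by apply: val_inj; rewrite /= inordK.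
  by rewrite /= edge_list_adj_inord.
- by rewrite -val_eqE /= !inordK.
- by rewrite connect1 // edge_list_unrooted_adj.
apply/card_gt2P; exists (inord 1), (inord 3), (inord 4).
by rewrite !inE !edge_list_unrooted_adj // -!val_eqE /= !inordK.
Qed.

(** * Yam graphs *)

Lemma is_path_index (T : finType) (G : sgraph T) : is_path G ->
  exists2 k : T -> nat, injective k &
    forall x y, adj G x y = ((k x).+1 == k y) || ((k y).+1 == k x).
Proof.
move=> [m [f [[g fK gK] f_adj]]]; exists (fun x => val (g x)).
  exact: inj_comp val_inj (can_inj gK).
by move=> x y; rewrite -{1}[x]gK -{1}[y]gK f_adj.
Qed.

Lemma is_path_deg (T : finType) (G : sgraph T) x : is_path G -> deg G x <= 2.
Proof.
move=> /is_path_index[k k_inj kP]; rewrite leqNgt; apply/negP.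
move=> /card_gt2P[y1 [y2 [y3]]]; rewrite !inE !kP -!(inj_eq k_inj).
by move=> [[xy1 xy2 xy3] [n12 n23 n31]]; lia.
Qed.

Lemma is_path_acyclic (T : finType) (G : sgraph T) : is_path G -> ~ cyclic (adj G).
Proof.
move=> /is_path_index[k k_inj kP] /(cyclic_linkedP (@adj_sym _ G) (@adj_irr _ G)).
move=> [b [x [y [nxy bx by_ cxy]]]].
have side : (k y < k b) = (k x < k b).
  apply: (connect_ind (P := fun z => (k z < k b) = (k x < k b)) _ _ cxy) => // z w <-.
  by rewrite avoidE kP -!(inj_eq k_inj) => /and3P[]; lia.
by move: side nxy bx by_; rewrite !kP -(inj_eq k_inj); lia.
Qed.

Section SimplePaths.
Variables (T : finType) (e : rel T).
Hypothesis e_sym : symmetric e.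

Definition simple_path (s : seq T) : bool := sorted e s && uniq s.

Definition longest_path (s : seq T) : Prop :=
  simple_path s /\ forall t, simple_path t -> size t <= size s.

Lemma simple_path_step x0 s k :
  simple_path s -> k.+1 < size s -> e (nth x0 s k) (nth x0 s k.+1).
Proof. by case/andP=> /(sortedP x0) + _; apply. Qed.

Lemma longest_path_exists : exists s, longest_path s.
Proof.
pose P n := [exists t : n.-tuple T, simple_path t].
have P_size t : simple_path t -> P (size t).
  by move=> simple_t; apply/existsP; exists (in_tuple t).
have P_bound n : P n -> n <= #|T|.
  by move=> /existsP[t /andP[_ /card_uniqP]]; rewrite size_tuple => <-; apply: max_card.
have P0 : exists n, P n by exists 0; apply: (P_size [::]).
case: (ex_maxnP P0 P_bound) => n /existsP[s simple_s] max_n.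
by exists s; split=> // t /P_size; rewrite size_tuple; apply: max_n.
Qed.

Lemma acyclic_simple_path_induced x0 s a b : ~ cyclic e -> simple_path s ->
  a < b -> b < size s -> e (nth x0 s a) (nth x0 s b) -> b = a.+1.
Proof.
move=> acyclic /andP[sorted_s uniq_s] lt_ab lt_bs ab.
apply: contrapT => nb; apply: acyclic.
pose t := drop a (take b.+1 s).
have size_t : size t = (b - a).+1 by rewrite size_drop size_takel // subSn // ltnW.
have nth_t k : k <= b - a -> nth x0 t k = nth x0 s (a + k).
  by move=> le_k; rewrite nth_drop nth_take //; lia.
have uniq_t : uniq t by rewrite drop_uniq // take_uniq.
have sorted_t : sorted e t by rewrite drop_sorted // take_sorted.
exists t; split; first by lia.
have last_t : last x0 t = nth x0 s b.
  by rewrite -nth_last size_t nth_t // subnKC // ltnW.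
have head_t : nth x0 t 0 = nth x0 s a by rewrite nth_t ?addn0.
rewrite /ucycle uniq_t andbT; case: (t) size_t sorted_t last_t head_t => //= x p _.
move=> path_p last_p head_p.
by rewrite rcons_path path_p last_p head_p e_sym.
Qed.

Lemma longest_path_closed s v w :
  (forall x, #|[set y | e x y]| <= 2) -> longest_path s -> v \in s -> e v w -> w \in s.
Proof.
move=> deg_le2 [simple_s longest] vs vw; apply: contraT => nws.
have [sorted_s uniq_s] := andP simple_s.
have /(nthP v)[k lt_ks Ev] := vs; rewrite -{}Ev in vw.
have [k0|k_gt0] := posnP k.
  suff /longest : simple_path (w :: s) by rewrite /= ltnn.
  rewrite /simple_path /= nws uniq_s andbT; move: sorted_s vw; rewrite k0.
  by case: (s) vs => //= y t _ -> yw; rewrite e_sym yw.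
have [k_last|k_inner] := eqVneq k.+1 (size s).
  suff /longest : simple_path (rcons s w) by rewrite size_rcons ltnn.
  rewrite /simple_path rcons_uniq nws uniq_s !andbT.
  have Ek : k = (size s).-1 by rewrite -k_last.
  move: sorted_s vw; rewrite Ek nth_last; case: (s) vs => //= y t _ path_t tw.
  by rewrite rcons_path path_t.
have lt_k1s : k.+1 < size s by rewrite ltn_neqAle k_inner.
have := deg_le2 (nth v s k); rewrite leqNgt => /negP; case; apply/card_gt2P.
exists (nth v s k.-1), (nth v s k.+1), w; rewrite !inE; split; split=> //.
- by rewrite e_sym -{2}(prednK k_gt0) simple_path_step // prednK.
- exact: simple_path_step.
- by rewrite nth_uniq //; lia.
- by apply: contraNneq nws => <-; rewrite mem_nth.
- by apply: contraNneq nws => ->; rewrite mem_nth //; lia.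
Qed.

End SimplePaths.

Lemma acyclic_deg2_is_path (T : finType) (G : sgraph T) :
  inhabited T -> connected_graph G -> ~ cyclic (adj G) -> (forall x, deg G x <= 2) ->
  is_path G.
Proof.
move=> [x0] G_conn acyclic deg_le2; have G_sym := @adj_sym _ G.
have [s longest_s] := longest_path_exists (adj G).
have [simple_s max_s] := longest_s; have [sorted_s uniq_s] := andP simple_s.
have s_gt0 : 0 < size s by apply: (max_s [:: x0]).
have all_s w : w \in s.
  apply: (connect_ind (P := fun z => z \in s) _ _ (G_conn (nth x0 s 0) w)) => [|a b].
    exact: mem_nth.
  exact: longest_path_closed.
have [m size_s] : exists m, size s = m.+1 by exists (size s).-1; rewrite prednK.
have lt_ord (k : 'I_m.+1) : k < size s by rewrite size_s.
exists m, (fun k : 'I_m.+1 => nth x0 s k); split.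
  exists (fun w => inord (index w s)) => [k|w].
    by rewrite index_uniq // inord_val.
  by rewrite inordK ?nth_index // -size_s index_mem.
have consec := acyclic_simple_path_induced (x0 := x0) G_sym acyclic simple_s.
move=> a b; apply/idP/orP => [|[/eqP E|/eqP E]].
- case: (ltngtP a b) => [ab|ba|/val_inj->]; last by rewrite adj_irr.
    by move/(consec _ _ ab (lt_ord b))->; left.
  by rewrite adj_sym => /(consec _ _ ba (lt_ord a))->; right.
- by rewrite -E simple_path_step // E.
- by rewrite -E adj_sym simple_path_step // E.
Qed.

(* [g] identifies the graph [eU] with a union of components of [e]. *)
Section UnionOfComponents.
Variables (U V : finType) (eU : rel U) (e : rel V) (g : U -> V).
Hypotheses (g_inj : injective g) (g_e : forall a b, e (g a) (g b) = eU a b)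
  (g_closed : forall a w, e (g a) w -> exists b, g b = w).

Lemma component_connect a w :
  connect e (g a) w -> exists2 b, g b = w & connect eU a b.
Proof.
pose P w' := exists2 b, g b = w' & connect eU a b.
apply: (connect_ind (P := P)); first by exists a.
move=> _ w' [b <- cab] bw'; have [b' Eb'] := g_closed bw'; exists b' => //.
by apply: connect_trans cab (connect1 _); rewrite -g_e Eb'.
Qed.

Lemma component_degree a : #|[set b | eU a b]| = #|[set w | e (g a) w]|.
Proof.
rewrite -(card_imset _ g_inj); apply: eq_card => w; rewrite inE.
apply/imsetP/idP => [[b + ->]|gaw]; first by rewrite inE g_e.
by have [b Eb] := g_closed gaw; exists b; rewrite // inE -g_e Eb.
Qed.

Lemma component_cyclic s a : 2 < size s -> ucycle e s -> g a \in s -> cyclic eU.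
Proof.
move=> s_gt2 /andP[cycle_s uniq_s] as_.
have s_codom : {subset s <= codom g}.
  move=> w ws; have [b <- _] := component_connect (connect_cycle cycle_s as_ ws).
  exact: codom_f.
exists (preim_seq g s); rewrite -(size_map g) /ucycle -(map_inj_uniq g_inj).
rewrite map_preim // s_gt2 uniq_s andbT; split=> //.
by move: cycle_s; rewrite -{1}(map_preim s_codom) cycle_map (eq_cycle g_e).
Qed.

End UnionOfComponents.

Lemma val_component_closed (T : finType) (G : sgraph T) x
    (a : {y | y \in component G x}) w :
  adj G (val a) w -> exists b : {y | y \in component G x}, val b = w.
Proof.
move=> aw; have wC : w \in component G x; last by exists (Sub w wC).
by have := valP a; rewrite !inE => cxa; apply: connect_trans cxa (connect1 aw).
Qed.

Lemma component_connected (T : finType) (G : sgraph T) x :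
  connected_graph (induced G (component G x)).
Proof.
set GC := induced G _; have xC : x \in component G x by rewrite inE connect0.
have conn_x a : connect (adj GC) (Sub x xC) a.
  have cxa : connect (adj G) (val (Sub x xC : {y | y \in component G x})) (val a).
    by have := valP a; rewrite inE.
  have val_adj (b c : {y | y \in component G x}) :
    adj G (val b) (val c) = adj GC b c by [].
  have [b /val_inj <- //] :=
    component_connect val_adj (@val_component_closed _ G x) cxa.
move=> a b; apply: connect_trans (conn_x b).
by rewrite connectC //; apply: adj_sym.
Qed.

Section Yam.
Variable H : rgraph.
Let G := graph H.
Let i := root H.
Let e : rel (vertex H) := @unrooted_adj H.
Let Gi := induced G [set~ i].

Section RootComponent.
Variable x : {x | x \in [set~ i]}.
Let C := component Gi x.
Let GC := induced Gi C.

Definition component_val (z : {y | y \in C}) : vertex H := val (val z).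

Lemma component_val_inj : injective component_val.
Proof. by move=> a b /val_inj/val_inj. Qed.

Lemma component_val_root z : component_val z != i.
Proof. by have := valP (val z); rewrite !inE. Qed.

Lemma component_val_adj a b : e (component_val a) (component_val b) = adj GC a b.
Proof. by rewrite /e unrooted_adjE !component_val_root. Qed.

Lemma component_val_closed a w : e (component_val a) w -> exists b, component_val b = w.
Proof.
move=> /and3P[_ nw aw]; have w_in : w \in [set~ i] by rewrite !inE.
have [|b Eb] := @val_component_closed _ Gi x a (Sub w w_in); last first.
  by exists b; rewrite /component_val Eb.
by rewrite /= /induced_adj SubK.
Qed.

Lemma component_base : exists z, component_val z = val x.
Proof.
have xC : x \in C by rewrite inE connect0.
by exists (Sub x xC); rewrite /component_val SubK.
Qed.

Lemma component_deg z : deg GC z = #|[set w | e (component_val z) w]|.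
Proof.
exact: component_degree component_val_inj component_val_adj component_val_closed z.
Qed.

Lemma connect_component a b : connect e (component_val a) (component_val b).
Proof.
apply: connect_map (component_connected a b) => c d.
by rewrite -component_val_adj; apply: connect1.
Qed.

Lemma component_acyclic : ~ cyclic e -> ~ cyclic (adj GC).
Proof.
move=> acyclic cyc; apply: acyclic; apply: cyclic_map component_val_inj _ cyc => a b.
by rewrite component_val_adj.
Qed.

End RootComponent.

Lemma component_val_onto j :
  j != i -> exists x (z : {y | y \in component Gi x}), component_val z = j.
Proof.
move=> nj; have j_in : j \in [set~ i] by rewrite !inE.
by have [z] := component_base (Sub j j_in); rewrite SubK; exists (Sub j j_in), z.
Qed.

Lemma yam_acyclic : yam_graph H -> ~ cyclic e.
Proof.
move=> [_ yam] [s [s_gt2 ucycle_s]]; have [cycle_s _] := andP ucycle_s.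
have [j js] : exists j, j \in s.
  by case: (s) s_gt2 => // j p _; exists j; apply: mem_head.
have nj : j != i by have /and3P[] := next_cycle cycle_s js.
have [x [z Ez]] := component_val_onto nj; rewrite -Ez in js.
have cyc := component_cyclic (@component_val_inj _) (@component_val_adj _)
  (@component_val_closed _) s_gt2 ucycle_s js.
by have [[[[_ _ /(_ cyc)]]|/is_path_acyclic]] := yam x.
Qed.

Lemma yam_not_branching : yam_graph H -> ~ branching H.
Proof.
move=> [_ yam] [j [b [ij njb cjb deg_b]]].
have nj : j != i by rewrite eq_sym (edge_neq (@adj_irr _ _) ij).
have [x [z Ez]] := component_val_onto nj; rewrite -Ez in ij njb cjb.
have [zb Eb _] := component_connect (@component_val_adj x) (@component_val_closed x) cjb.
have deg_zb : 2 < deg (induced Gi (component Gi x)) zb by rewrite component_deg Eb.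
have [[star|path] centre] := yam x; last first.
  by have := is_path_deg zb path; rewrite leqNgt deg_zb.
have [_ deg_z] := centre star z ij; have [_ [c [_ c_uniq]]] := star.
by move: njb; rewrite -Eb -(c_uniq _ deg_z) -(c_uniq _ deg_zb) eqxx.
Qed.

Lemma not_obstructed_yam : connected_graph G -> ~ obstructed H -> yam_graph H.
Proof.
move=> G_conn nobs; split=> // x; set C := component Gi x; set GC := induced Gi C.
have GC_acyclic : ~ cyclic (adj GC).
  by apply: component_acyclic => cyc; apply: nobs; left.
have GC_conn : connected_graph GC by apply: component_connected.
have [z0 Ez0] := component_base x.
have centre z c : adj G i (component_val z) -> 2 < deg GC c -> z = c.
  move=> iz deg_c; apply: contrapT => /eqP nzc; apply: nobs; right.
  exists (component_val z), (component_val c); split=> //.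
  - exact: connect_component.
  - by rewrite -component_deg.
have [j ij] : exists z : {y | y \in C}, adj G i (component_val z).
  have nxi : val x != i by have := valP x; rewrite !inE.
  have [w [nw cxw wi]] := connect_last_edge (G_conn (val x) i) nxi; rewrite -Ez0 in cxw.
  have [b Eb _] := component_connect (@component_val_adj x) (@component_val_closed x) cxw.
  by exists b; rewrite adj_sym Eb.
split; last first.
  by move=> star z iz; split=> //; case: star => _ [c [deg_c _]]; rewrite (centre z c).
have [[c deg_c]|small] := pselect (exists c, 2 < deg GC c); [left | right].
  split; first by split=> //; exists.
  by exists c; split=> // d deg_d; rewrite -(centre j c) // -(centre j d).
apply: acyclic_deg2_is_path => // z; rewrite leqNgt; apply/negP => deg_z.
by apply: small; exists z.
Qed.

Lemma yam_graphP : connected_graph G -> yam_graph H <-> ~ obstructed H.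
Proof.
move=> G_conn; split=> [yam|]; last exact: not_obstructed_yam.
by case=> [/(yam_acyclic yam)|/(yam_not_branching yam)].
Qed.

End Yam.

(** * Parter vertices and the strong Arnold property *)

Import Order.TTheory GRing.Theory Num.Theory.
Local Open Scope ring_scope.

Lemma natr_bool_neq0 (R : nzRingType) (b : bool) : (b%:R != 0 :> R) = b.
Proof. by case: b; rewrite ?oner_eq0 ?eqxx. Qed.

Section Dot.
Variables (F : fieldType) (n : nat).
Implicit Types (u v w : 'rV[F]_n) (A : 'M[F]_n).

Definition dot u v : F := (u *m v^T) 0 0.

Lemma dotE u v : dot u v = \sum_k u 0 k * v 0 k.
Proof. by rewrite /dot mxE; apply: eq_bigr => k _; rewrite mxE. Qed.

Lemma dotC u v : dot u v = dot v u.
Proof. by rewrite !dotE; apply: eq_bigr => k _; rewrite mulrC. Qed.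

Lemma mulmx_tr_dot u v : u *m v^T = (dot u v)%:M.
Proof. exact: mx11_scalar. Qed.

Lemma dot0l v : dot 0 v = 0.
Proof. by rewrite /dot mul0mx mxE. Qed.

Lemma dotDl u v w : dot (u + v) w = dot u w + dot v w.
Proof. by rewrite /dot mulmxDl mxE. Qed.

Lemma dotZl a u v : dot (a *: u) v = a * dot u v.
Proof. by rewrite /dot -scalemxAl mxE. Qed.

Lemma dot_deltal k v : dot (delta_mx 0 k) v = v 0 k.
Proof. by rewrite /dot -rowE !mxE. Qed.

Lemma dot_mulmx_sym A u v : A^T = A -> dot (u *m A) v = dot u (v *m A).
Proof. by move=> A_sym; rewrite /dot trmx_mul A_sym mulmxA. Qed.

End Dot.

Section Parter.
Variables (F : fieldType) (n : nat) (i : 'I_n).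
Implicit Types (A B : 'M[F]_n) (w : 'rV[F]_n).

(* The kernel of A(i), with a zero coordinate inserted at [i]. *)
Definition punctured_kermx A : 'M[F]_(n.-1, n) :=
  kermx (row' i (col' i A)) *m row' i 1%:M.

Lemma col'_mul_row'1 (w : 'rV[F]_n.-1) : col' i (w *m row' i 1%:M) = w.
Proof.
apply/rowP => k; rewrite mxE mxE (bigD1 k) //= !mxE eqxx mulr1 big1 ?addr0 // => l nlk.
by rewrite !mxE (inj_eq (@lift_inj _ i)) (negPf nlk) mulr0.
Qed.

Lemma mul_row'1_root (w : 'rV[F]_n.-1) : (w *m row' i 1%:M) 0 i = 0.
Proof.
by rewrite mxE big1 // => k _; rewrite !mxE eq_sym (negPf (neq_lift _ _)) mulr0.
Qed.

Lemma col'K_row'1 w : w 0 i = 0 -> col' i w *m row' i 1%:M = w.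
Proof.
move=> wi; apply/rowP => k; rewrite -[w in RHS]mulmx1 !mxE.
rewrite (bigD1_ord i) //= wi mul0r add0r.
by apply: eq_bigr => l _; rewrite !mxE.
Qed.

Lemma row_free_row'1 : row_free (row' i 1%:M : 'M[F]_(n.-1, n)).
Proof. by apply: inj_row_free => w w0; rewrite -[w]col'_mul_row'1 w0 raddf0. Qed.

Lemma col'_mul_punctured A w :
  w 0 i = 0 -> col' i w *m row' i (col' i A) = col' i (w *m A).
Proof.
move=> wi; rewrite row'Esub rowsubE -row'Esub mulmxA col'K_row'1 //.
by rewrite !col'Esub mulmx_colsub.
Qed.

Lemma punctured_kermxP A w :
  reflect (w 0 i = 0 /\ forall k, k != i -> (w *m A) 0 k = 0)
          (w <= punctured_kermx A)%MS.
Proof.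
apply: (iffP idP) => [/submxP[c]|[wi wA]].
  rewrite /punctured_kermx mulmxA => ->; rewrite mul_row'1_root; split=> // k.
  case: (unliftP i k) => [l ->|->]; last by rewrite eqxx.
  have := col'_mul_punctured A (mul_row'1_root (c *m kermx (row' i (col' i A)))).
  rewrite col'_mul_row'1 -mulmxA mulmx_ker mulmx0 => /rowP/(_ l) + _.
  by rewrite !mxE => <-.
rewrite -[w]col'K_row'1 //; apply/submxMr/sub_kermxP; rewrite col'_mul_punctured //.
by apply/rowP => k; rewrite [RHS]mxE mxE wA // eq_sym neq_lift.
Qed.

Lemma mxrank_punctured_kermx A :
  \rank (punctured_kermx A) = \rank (kermx (row' i (col' i A))).
Proof. exact/mxrankMfree/row_free_row'1. Qed.

Lemma eq_punctured_kermx A B :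
  (forall k l, k != i -> l != i -> A k l = B k l) ->
  (punctured_kermx A :=: punctured_kermx B)%MS.
Proof.
move=> AB; rewrite /punctured_kermx.
suff -> : row' i (col' i A) = row' i (col' i B) by [].
by apply/matrixP => k l; rewrite !mxE AB // eq_sym neq_lift.
Qed.

Lemma punctured_kermx_mul A w :
  (w <= punctured_kermx A)%MS -> w *m A = (w *m A) 0 i *: delta_mx 0 i.
Proof.
case/punctured_kermxP=> _ wA; apply/rowP => k.
rewrite [RHS]mxE [delta_mx _ _ _ _]mxE eqxx /=.
by have [->|/wA->] := eqVneq k i; rewrite (mulr1, mulr0).
Qed.

Lemma punctured_kermx_isolated A : A^T = A -> A i i != 0 ->
  (forall k, k != i -> A i k = 0) -> (punctured_kermx A :=: kermx A)%MS.
Proof.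
move=> A_sym nAii Ai; have mulA_i w : (w *m A) 0 i = w 0 i * A i i.
  rewrite mxE (bigD1 i) //= big1 ?addr0 // => k nki.
  by rewrite -A_sym mxE Ai // mulr0.
apply/eqmxP/andP; split; apply/rV_subP => w.
  case/punctured_kermxP=> wi wA; apply/sub_kermxP/rowP => k; rewrite [RHS]mxE.
  by have [->|/wA //] := eqVneq k i; rewrite mulA_i wi mul0r.
move/sub_kermxP => wA; apply/punctured_kermxP; split=> [|k _]; last by rewrite wA mxE.
by have /eqP := mulA_i w; rewrite wA mxE eq_sym mulf_eq0 (negPf nAii) orbF => /eqP.
Qed.

Lemma mulmx_col_eq0 A w : (w *m col i A == 0) = ((w *m A) 0 i == 0).
Proof.
have -> : w *m col i A = ((w *m A) 0 i)%:M.
  by rewrite [LHS]mx11_scalar !mxE; congr _%:M; apply: eq_bigr => k _; rewrite mxE.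
apply/eqP/eqP => [/matrixP/(_ 0 0)|->]; last by rewrite raddf0.
by rewrite !mxE eqxx mulr1n.
Qed.

Definition parter_vertex A : Prop :=
  exists2 v : 'rV_n, (v <= punctured_kermx A)%MS & (v *m A) 0 i != 0.

Lemma sub_kermx_parter A w : A^T = A -> parter_vertex A ->
  (w <= kermx A)%MS = (w <= punctured_kermx A)%MS && ((w *m A) 0 i == 0).
Proof.
move=> A_sym [v vP nvA]; apply/sub_kermxP/andP => [wA|[wP /eqP wAi]]; last first.
  by rewrite (punctured_kermx_mul wP) wAi scale0r.
split; last by rewrite wA mxE.
apply/punctured_kermxP; split=> [|k _]; last by rewrite wA mxE.
have : dot (v *m A) w = 0 by rewrite dot_mulmx_sym // wA dotC dot0l.
rewrite (punctured_kermx_mul vP) dotZl dot_deltal => /eqP.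
by rewrite mulf_eq0 (negPf nvA) => /eqP.
Qed.

Lemma parterP A : A^T = A ->
  parter_vertex A <-> \rank (punctured_kermx A) = (\rank (kermx A)).+1.
Proof.
move=> A_sym; split=> [parter|rank_P].
  have -> : \rank (kermx A) = \rank (punctured_kermx A :&: kermx (col i A))%MS.
    apply/eqmx_rank/andP; split; apply/rV_subP => w;
      by rewrite sub_capmx sub_kermx_parter // sub_kermx mulmx_col_eq0.
  rewrite -[LHS](mxrank_mul_ker _ (col i A)) -[RHS]add1n; congr (_ + _)%N.
  apply/eqP; rewrite eqn_leq rank_leq_col lt0n mxrank_eq0.
  have [v /submxP[c ->]] := parter; apply: contraNneq => PA.
  by rewrite -mulmx_col_eq0 -mulmxA PA mulmx0.
apply: contrapT => nparter; suff /mxrankS : (punctured_kermx A <= kermx A)%MS.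
  by rewrite rank_P ltnn.
apply/rV_subP => w wP; apply/sub_kermxP; rewrite (punctured_kermx_mul wP).
have [->|nw] := eqVneq ((w *m A) 0 i) 0; first by rewrite scale0r.
by case: nparter; exists w.
Qed.

End Parter.

Section StrongArnold.
Variables (R : realType) (n : nat).

Definition strong_arnold (e : rel 'I_n) (m : nat) (K : 'M[R]_(m, n)) : Prop :=
  forall X : 'M[R]_n, X^T = X ->
    (forall k l, (k == l) || e k l -> X k l = 0) -> (X <= K)%MS -> X = 0.

Lemma strong_arnold_eqmx e m1 m2 (K1 : 'M_(m1, n)) (K2 : 'M_(m2, n)) :
  (K1 :=: K2)%MS -> strong_arnold e K1 -> strong_arnold e K2.
Proof. by move=> eqK saK1 X X_sym X0; rewrite -eqK; apply: saK1. Qed.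

Lemma strong_arnold_separated e m (K : 'M_(m, n)) (x y : 'rV_n) :
  symmetric e -> strong_arnold e K -> (x <= K)%MS -> (y <= K)%MS ->
  (forall k l, x 0 k != 0 -> y 0 l != 0 -> ~~ ((k == l) || e k l)) -> x = 0 \/ y = 0.
Proof.
move=> e_sym saK xK yK separated.
have xy0 k l : (k == l) || e k l -> x 0 k * y 0 l = 0.
  apply: contraTeq; rewrite mulf_eq0 negb_or => /andP[]; exact: separated.
pose X := x^T *m y + y^T *m x.
have XE k l : X k l = x 0 k * y 0 l + y 0 k * x 0 l.
  by rewrite !mxE !big_ord1 !mxE.
have X0 : X = 0.
  apply: saK; last by rewrite addmx_sub // mulmx_sub.
    by apply/matrixP => k l; rewrite mxE !XE addrC ![y 0 _ * _]mulrC.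
  move=> k l kl; rewrite XE xy0 // mulrC xy0 ?addr0 //.
  by rewrite eq_sym e_sym.
have [->|/rV0Pn[k nxk]] := eqVneq x 0; [by left | right].
apply/rowP => l; rewrite [RHS]mxE; apply/eqP; apply: contraT => nyl.
have := xy0 k k; rewrite eqxx => /(_ isT)/eqP; rewrite mulf_eq0 (negPf nxk) => /eqP yk.
have := XE k l; rewrite X0 mxE yk mul0r addr0 => /esym/eqP.
by rewrite mulf_eq0 (negPf nxk) (negPf nyl).
Qed.

Lemma nullityE (A : 'M[R]_n) : nullity A = \rank (kermx A).
Proof. by rewrite /nullity mxrank_coker mxrank_ker. Qed.

Lemma hadamard_eq0P (A X : 'M[R]_n) :
  hadamard A X = 0 <-> forall k l, A k l != 0 -> X k l = 0.
Proof.
split=> [/matrixP AX k l nA|AX].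
  by have /eqP := AX k l; rewrite !mxE mulf_eq0 (negPf nA) => /eqP.
apply/matrixP => k l; rewrite !mxE.
by have [->|/AX->] := eqVneq (A k l) 0; rewrite ?mul0r ?mulr0.
Qed.

End StrongArnold.

Section SNIP.
Variables (R : realType) (n : nat) (G : sgraph 'I_n) (i : 'I_n) (A : 'M[R]_n).
Hypothesis A_S : in_S G A.
Let e : rel 'I_n := @unrooted_adj (RGraph G i).

Lemma in_S_edge k l : k != i -> l != i -> k != l -> (A k l != 0) = e k l.
Proof. by move=> nki nli nkl; rewrite A_S.2 // /e unrooted_adjE nki nli. Qed.

Lemma mulmx_in_S_sym (X : 'M[R]_n) k l : X^T = X -> (A *m X) k l = (row l X *m A) 0 k.
Proof.
move=> X_sym; have AX : (A *m X)^T = X *m A by rewrite trmx_mul X_sym A_S.1.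
by rewrite -row_mul -AX [RHS]mxE [RHS]mxE.
Qed.

Lemma SNIP_strong_arnold : SNIP i A -> strong_arnold e (punctured_kermx i A).
Proof.
move=> snip X X_sym X0 XK; have X_symE k l : X k l = X l k by rewrite -{1}X_sym mxE.
have rowK l : (row l X <= punctured_kermx i A)%MS := submx_trans (row_sub l X) XK.
have Xi l : X l i = 0 by have /punctured_kermxP[] := rowK l; rewrite mxE.
apply: snip => //.
- apply/hadamard_eq0P => k l nA; have [->|nkl] := eqVneq k l; first by rewrite X0 ?eqxx.
  have [->|nki] := eqVneq k i; first by rewrite X_symE Xi.
  have [->|nli] := eqVneq l i; first by rewrite Xi.
  by apply: X0; rewrite -in_S_edge // nA orbT.
- by apply/hadamard_eq0P => k l; rewrite mxE natr_bool_neq0 => /eqP->; rewrite X0 ?eqxx.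
apply/matrixP => k l; rewrite [RHS]mxE mxE mulmx_in_S_sym //.
by have /punctured_kermxP[_] := rowK l; apply; rewrite eq_sym neq_lift.
Qed.

Lemma strong_arnold_SNIP :
  parter_vertex i A -> strong_arnold e (punctured_kermx i A) -> SNIP i A.
Proof.
move=> [v vK nvA] saK X X_sym /hadamard_eq0P AX /hadamard_eq0P IX AX0.
have AX_off k l : k != i -> (A *m X) k l = 0.
  case: (unliftP i k) => [k' ->|->]; last by rewrite eqxx.
  by move/matrixP/(_ k' l): AX0 => + _; rewrite !mxE.
have rowi : row i X = 0.
  have : v *m (A *m X) = 0.
    apply/rowP => l; rewrite mxE big1 ?mxE // => k _.
    have [->|nki] := eqVneq k i; last by rewrite AX_off // mulr0.
    by have /punctured_kermxP[-> _] := vK; rewrite mul0r.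
  rewrite mulmxA (punctured_kermx_mul vK) -scalemxAl -rowE => /eqP.
  by rewrite scaler_eq0 (negPf nvA) => /eqP.
apply: saK => // [k l /orP[/eqP->|kl]|].
- by apply: IX; rewrite mxE eqxx oner_eq0.
- have /and3P[nki nli _] := kl; apply: AX.
  by rewrite in_S_edge // (edge_neq (@unrooted_irr (RGraph G i)) kl).
apply/row_subP => l; apply/punctured_kermxP; split=> [|k nki].
  by have /rowP/(_ l) := rowi; rewrite !mxE => <-; rewrite -[in LHS]X_sym mxE.
by rewrite -mulmx_in_S_sym // AX_off.
Qed.

End SNIP.

(** * From the nullity pair (1,2) to an obstruction *)

Section KernelSupport.
Variables (R : realType) (n : nat) (G : sgraph 'I_n) (i : 'I_n) (A : 'M[R]_n).
Hypothesis A_S : in_S G A.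
Let e : rel 'I_n := @unrooted_adj (RGraph G i).
Let K := punctured_kermx i A.

Let e_sym : symmetric e := @unrooted_sym (RGraph G i).
Let e_irr : irreflexive e := @unrooted_irr (RGraph G i).
Let A_edge k l : k != i -> l != i -> k != l -> (A k l != 0) = e k l.
Proof. exact: in_S_edge. Qed.

Definition restrict_row (C : pred 'I_n) (x : 'rV[R]_n) : 'rV[R]_n :=
  \row_k (if C k then x 0 k else 0).

Lemma restrict_row_mul (C : pred 'I_n) (x : 'rV[R]_n) k :
  (forall l, x 0 l != 0 -> A l k != 0 -> C l = C k) ->
  (restrict_row C x *m A) 0 k = if C k then (x *m A) 0 k else 0.
Proof.
move=> closedC; transitivity (\sum_l (if C k then x 0 l * A l k else 0)); last first.
  by case: (C k); [rewrite mxE | apply: big1].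
rewrite mxE; apply: eq_bigr => l _; rewrite mxE.
have [->|nx] := eqVneq (x 0 l) 0; first by rewrite if_same mul0r if_same.
have [->|nA] := eqVneq (A l k) 0; first by rewrite !mulr0 if_same.
by rewrite (closedC l nx nA); case: (C k); rewrite ?mul0r.
Qed.

Lemma kernel_support_root (x : 'rV_n) k : (x <= K)%MS -> x 0 k != 0 -> k != i.
Proof. by case/punctured_kermxP=> xi _; apply: contraNneq => ->; rewrite xi. Qed.

Lemma restrict_row_kernel (C : pred 'I_n) (x : 'rV_n) :
  (forall k l, e k l -> C k = C l) -> (x <= K)%MS -> (restrict_row C x <= K)%MS.
Proof.
move=> closedC xK; have /punctured_kermxP[xi xA] := xK.
apply/punctured_kermxP; split=> [|k nki]; first by rewrite mxE xi if_same.
rewrite restrict_row_mul ?xA ?if_same // => l nxl nA.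
have [-> //|nlk] := eqVneq l k; apply: closedC.
by rewrite -(A_edge (kernel_support_root xK nxl) nki nlk).
Qed.

Lemma kernel_support_connected (x y : 'rV_n) j l : strong_arnold e K ->
  (x <= K)%MS -> (y <= K)%MS -> x 0 j != 0 -> y 0 l != 0 -> connect e j l.
Proof.
move=> saK xK yK nxj nyl; pose C : pred 'I_n := connect e j.
have closedC a b : e a b -> C a = C b by apply: connect_edge_eq.
have [||a b|/rowP/(_ j)|/rowP/(_ l)] := strong_arnold_separated
    (x := restrict_row C x) (y := restrict_row (predC C) y) e_sym saK.
- exact: restrict_row_kernel.
- by apply: restrict_row_kernel => // a b /closedC E /=; rewrite E.
- rewrite !mxE /=; have [Ca _|_] := boolP (C a); last by rewrite eqxx.
  have [|nCb _] := boolP (C b); first by rewrite eqxx.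
  by apply: contraNN nCb => /orP[/eqP<-|/closedC <-].
- by rewrite !mxE /C connect0 => xj; rewrite xj eqxx in nxj.
- by rewrite !mxE /=; case: ifP => [_ yl|/negbFE //]; rewrite yl eqxx in nyl.
Qed.

(* The restriction of [w] to the branch at [j] through [x] is orthogonal to
   [v *m A], so its product with [A] vanishes at [j] as well; there it is
   [w 0 x * A x j], because the branch meets the neighbors of [j] only in [x]. *)
Lemma kernel_zero_neighbor (v w : 'rV_n) j x : ~ cyclic e ->
  (v <= K)%MS -> (w <= K)%MS -> v 0 j != 0 -> w 0 j = 0 -> e j x -> w 0 x = 0.
Proof.
move=> acyclic vK wK nvj wj ejx; have nxj : x != j by rewrite eq_sym (edge_neq e_irr).
have /punctured_kermxP[vi _] := vK; have /punctured_kermxP[wi wA] := wK.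
pose L := connect (avoid e j) x; pose wL := restrict_row L w.
have e_support k l : l != i -> w 0 k != 0 -> k != l -> A k l != 0 -> e k l.
  by move=> nli nwk nkl; rewrite (A_edge (kernel_support_root wK nwk)).
have wL_off k : k != i -> k != j -> (wL *m A) 0 k = 0.
  move=> nki nkj; rewrite restrict_row_mul ?wA ?if_same // => l nwl nA.
  have [-> //|nlk] := eqVneq l k; apply: connect_edge_eq; first exact: induced_rel_sym.
  by rewrite avoidE nkj e_support // (contraNneq _ nwl) // => ->; rewrite wj.
have wLj : (wL *m A) 0 j = 0.
  have : dot (wL *m A) v = 0.
    rewrite dot_mulmx_sym ?A_S.1 // (punctured_kermx_mul vK) dotC dotZl dot_deltal.
    by rewrite [wL _ _]mxE wi if_same mulr0.
  rewrite dotE (bigD1 j) //= big1 ?addr0 => [/eqP|k nkj].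
    by rewrite mulf_eq0 (negPf nvj) orbF => /eqP.
  by have [->|nki] := eqVneq k i; rewrite ?vi ?mulr0 // wL_off ?mul0r.
have nji : j != i := kernel_support_root vK nvj.
move: wLj; rewrite mxE (bigD1 x) //= big1 ?addr0 => [|k nkx]; rewrite mxE.
  have nAxj : A x j != 0 by have /and3P[_ nxi _] := ejx; rewrite A_edge // e_sym.
  by rewrite /L connect0 => /eqP; rewrite mulf_eq0 (negPf nAxj) orbF => /eqP.
case: ifP => [Lk|_]; last exact: mul0r.
apply/eqP; apply: contraT; rewrite mulf_eq0 negb_or => /andP[nwk nA].
have nkj : k != j by apply: contraNneq nwk => ->; rewrite wj.
case: acyclic; apply/cyclic_linkedP => //; exists j, x, k; rewrite eq_sym; split=> //.
by rewrite e_sym e_support.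
Qed.

Lemma kernel_zero_step (w : 'rV_n) a b c :
  (w <= K)%MS -> (#|[set y | e b y]| <= 2)%N -> e b a -> e b c ->
  w 0 a = 0 -> w 0 b = 0 -> w 0 c = 0.
Proof.
move=> wK deg_b eba ebc wa wb; have /punctured_kermxP[wi wA] := wK.
have [nbi nci _] := and3P ebc; have ncb : c != b by rewrite eq_sym (edge_neq e_irr).
apply/eqP; apply: contraT => nwc.
have := wA b nbi; rewrite mxE (bigD1 c) //= big1 ?addr0 => [/eqP|l nlc].
  by rewrite mulf_eq0 (negPf nwc) /= => /negPn; rewrite A_edge // e_sym ebc.
apply/eqP; apply: contraTT deg_b; rewrite mulf_eq0 negb_or -ltnNge => /andP[nwl nA].
have neq_zero z y : w 0 z != 0 -> w 0 y = 0 -> z != y.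
  by move=> nwz wy; apply: contraNneq nwz => ->; rewrite wy.
have ebl : e b l.
  by rewrite e_sym -A_edge // ?(neq_zero _ _ nwl wb) // (kernel_support_root wK nwl).
apply/card_gt2P; exists a, c, l; rewrite !inE eba ebc ebl; split=> //.
by rewrite [a == c]eq_sym [c == l]eq_sym nlc !neq_zero.
Qed.

Lemma kernel_vector_zero (v w : 'rV_n) j : strong_arnold e K -> ~ cyclic e ->
  (forall b, j != b -> connect e j b -> #|[set y | e b y]| <= 2)%N ->
  (v <= K)%MS -> (w <= K)%MS -> v 0 j != 0 -> w 0 j = 0 -> w = 0.
Proof.
move=> saK acyclic deg_le2 vK wK nvj wj.
apply/rowP => s; rewrite [RHS]mxE; apply/eqP; apply: contraT => nws.
have csj : connect e s j.
  by rewrite connectC //; apply: kernel_support_connected saK vK wK nvj nws.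
have nsj : s != j by apply: contraNneq nws => ->; rewrite wj.
have [x [nxj csx exj]] := connect_last_edge csj nsj.
have cxs : connect (avoid e j) x s by rewrite connectC //; apply: induced_rel_sym.
have ejx : e j x by rewrite e_sym.
pose zero_near b := [/\ w 0 b = 0, connect e j b & exists2 a, e b a & w 0 a = 0].
suff [ws _ _] : zero_near s by rewrite ws eqxx in nws.
apply: (connect_ind (P := zero_near) _ _ cxs) => [|b c [wb cjb [a eba wa]]].
  split; [|exact: connect1 | by exists j].
  exact: (kernel_zero_neighbor acyclic vK wK nvj wj ejx).
rewrite avoidE => /and3P[nbj _ ebc].
split; [|exact: connect_trans cjb (connect1 ebc) | by exists b; rewrite 1?e_sym].
by apply: (kernel_zero_step wK) eba ebc wa wb; apply: deg_le2; rewrite 1?eq_sym.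
Qed.

End KernelSupport.

Lemma vanishing_row (F : fieldType) m n (K : 'M[F]_(m, n)) j : (1 < \rank K)%N ->
  exists w : 'rV_n, [/\ w != 0, (w <= K)%MS & w 0 j = 0].
Proof.
move=> rank_K; pose c : 'cV[F]_n := delta_mx j 0.
have : (K :&: kermx c)%MS != 0.
  rewrite -mxrank_eq0 -lt0n; have := mxrank_mul_ker K c; have := rank_leq_col (K *m c).
  by move: rank_K; lia.
case/rowV0Pn=> w; rewrite sub_capmx => /andP[wK /sub_kermxP wc] nw.
exists w; split=> //.
by have /matrixP/(_ 0 0) := wc; rewrite -colE !mxE.
Qed.

Lemma allows_obstructed (R : realType) (n : nat) (G : sgraph 'I_n) (i : 'I_n) :
  allows_with_SNIP R G i 1 2 -> obstructed (RGraph G i).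
Proof.
move=> [A [A_S [nullA nullAi] snip]]; set e := @unrooted_adj (RGraph G i).
have rankK : \rank (punctured_kermx i A) = 2%N.
  by rewrite mxrank_punctured_kermx -nullityE.
have parter : parter_vertex i A.
  by apply/parterP; rewrite ?A_S.1 // rankK -nullityE nullA.
have saK : strong_arnold e (punctured_kermx i A) := SNIP_strong_arnold A_S snip.
apply: contrapT => nobs; have [v vK /eqP] := parter; apply; rewrite mxE.
apply: big1 => j _; apply/eqP; apply: contraT.
rewrite mulf_eq0 negb_or => /andP[nvj nAj].
have nji : j != i := kernel_support_root vK nvj.
have ij : adj G i j by rewrite adj_sym -A_S.2.
have [|w [nw wK wj]] := vanishing_row (K := punctured_kermx i A) j.
  by rewrite rankK.
case/eqP: nw; apply: kernel_vector_zero saK _ _ vK wK nvj wj => //.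
  by move=> cyc; apply: nobs; left.
move=> b njb cjb; rewrite leqNgt; apply/negP => deg_b.
by apply: nobs; right; exists j, b.
Qed.

(** * Bordered matrices and Laplacians *)

Section Border.
Variables (F : fieldType) (n : nat) (i : 'I_n) (b : 'rV[F]_n) (A : 'M[F]_n).
Implicit Types w : 'rV[F]_n.

Definition border : 'M[F]_n :=
  \matrix_(k, l) if k == i then b 0 l else if l == i then b 0 k else A k l.

Lemma border_sym : A^T = A -> border^T = border.
Proof.
move=> A_sym; apply/matrixP => k l; rewrite !mxE -{1}A_sym mxE.
by have [->|_] := eqVneq l i; have [E|_] := eqVneq k i; rewrite ?E.
Qed.

Lemma punctured_kermx_border : (punctured_kermx i border :=: punctured_kermx i A)%MS.
Proof.
by apply: eq_punctured_kermx => k l nki nli; rewrite mxE (negPf nki) (negPf nli).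
Qed.

Lemma mulmx_border_root w : w 0 i = 0 -> (w *m border) 0 i = dot w b.
Proof.
move=> wi; rewrite dotE mxE; apply: eq_bigr => k _; rewrite mxE eqxx.
by have [->|//] := eqVneq k i; rewrite wi !mul0r.
Qed.

Lemma parter_border v :
  (v <= punctured_kermx i A)%MS -> dot v b != 0 -> parter_vertex i border.
Proof.
move=> vK nvb; exists v; first by rewrite punctured_kermx_border.
by have /punctured_kermxP[vi _] := vK; rewrite mulmx_border_root.
Qed.

Lemma sub_kermx_border v w : A^T = A -> (v <= punctured_kermx i A)%MS -> dot v b != 0 ->
  (w <= kermx border)%MS = (w <= punctured_kermx i A)%MS && (dot w b == 0).
Proof.
move=> A_sym vK nvb.
rewrite (sub_kermx_parter w (border_sym A_sym) (parter_border vK nvb)).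
rewrite punctured_kermx_border; case: punctured_kermxP => //= -[wi _].
by rewrite mulmx_border_root.
Qed.

End Border.

Lemma row_with_support (F : numFieldType) n (P : pred 'I_n) (u : 'rV[F]_n) j :
  P j -> u 0 j != 0 ->
  exists2 b : 'rV[F]_n, forall k, (b 0 k != 0) = P k & dot u b != 0.
Proof.
move=> Pj nuj; pose ind : 'rV[F]_n := \row_k (P k)%:R.
have ind_neq0 k : (ind 0 k != 0) = P k by rewrite mxE natr_bool_neq0.
have [u_ind|] := eqVneq (dot u ind) 0; last by exists ind.
exists (ind + delta_mx 0 j) => [k|]; last first.
  by rewrite dotC dotDl dotC u_ind dot_deltal add0r.
rewrite mxE [delta_mx _ _ _ _]mxE eqxx.
have [->|_] := eqVneq k j; last by rewrite addr0.
by rewrite mxE Pj -natrD pnatr_eq0.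
Qed.

Lemma allows_of_kernel (R : realType) (n m : nat) (G : sgraph 'I_n) (i j : 'I_n)
    (B : 'M[R]_n) (v : 'rV_n) (e := @unrooted_adj (RGraph G i)) :
  B^T = B -> (forall k l, k != i -> l != i -> k != l -> (B k l != 0) = e k l) ->
  \rank (punctured_kermx i B) = m.+1 -> strong_arnold e (punctured_kermx i B) ->
  (v <= punctured_kermx i B)%MS -> adj G i j -> v 0 j != 0 ->
  allows_with_SNIP R G i m m.+1.
Proof.
move=> B_sym B_e rankB saB vK ij nvj.
have [b b_adj nvb] := row_with_support ij nvj; pose A := border i b B.
have eqK := punctured_kermx_border i b B : (punctured_kermx i A :=: _)%MS.
have A_sym : A^T = A by apply: border_sym.
have parter : parter_vertex i A by apply: parter_border nvb.
have A_S : in_S G A.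
  split=> // k l nkl; rewrite mxE; have [->|nki] := eqVneq k i; first exact: b_adj.
  have [->|nli] := eqVneq l i; first by rewrite b_adj adj_sym.
  by rewrite B_e // /e unrooted_adjE nki nli.
exists A; split=> //.
  have rankA : \rank (punctured_kermx i A) = m.+1 by rewrite eqK.
  rewrite /nullity_pair !nullityE -mxrank_punctured_kermx rankA; congr (_, _).
  by have := (parterP i A_sym).1 parter; rewrite rankA => -[].
exact/(strong_arnold_SNIP A_S parter)/(strong_arnold_eqmx (eqmx_sym eqK) saB).
Qed.

Lemma symmetric_mx_determined (F : fieldType) n m (K : 'M[F]_(m, n)) (P : pred 'I_n)
    (X : 'M[F]_n) :
  (forall w : 'rV_n, (w <= K)%MS -> (forall k, P k -> w 0 k = 0) -> w = 0) ->
  X^T = X -> (X <= K)%MS -> (forall k l, P k -> P l -> X k l = 0) -> X = 0.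
Proof.
move=> determined X_sym XK X0.
have rowK k : (row k X <= K)%MS := submx_trans (row_sub k X) XK.
have rowP0 k : P k -> row k X = 0.
  by move=> Pk; apply: determined => // l Pl; rewrite mxE X0.
apply/row_matrixP => k; rewrite row0; apply: determined => // l /rowP0/rowP/(_ k).
by rewrite !mxE => <-; rewrite -{1}X_sym mxE.
Qed.

Lemma sym_mx_range (F : fieldType) n (A : 'M[F]_n) (u : 'rV_n) : A^T = A ->
  (forall w : 'rV_n, w *m A = 0 -> dot w u = 0) -> exists t : 'rV_n, t *m A = u.
Proof.
move=> A_sym orth; suff /submxP[t ->] : (u <= A)%MS by exists t.
rewrite submxE -trmx_eq0 trmx_mul; apply/eqP/row_matrixP => k; rewrite row_mul row0.
rewrite mulmx_tr_dot orth ?raddf0 // -row_mul -[A in _ *m A]A_sym -trmx_mul mulmx_coker.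
by rewrite trmx0 row0.
Qed.

(* Subtracting from [M] the rank-one form of [u = t M], scaled so that [t] is
   isotropic for the difference, adds [t] to the kernel. *)
Section Downdate.
Variables (F : fieldType) (n : nat) (M : 'M[F]_n) (t u : 'rV[F]_n).
Hypotheses (M_sym : M^T = M) (tM : t *m M = u) (ntu : dot t u != 0).

Definition downdate : 'M[F]_n := M - (dot t u)^-1 *: (u^T *m u).

Lemma downdate_sym : downdate^T = downdate.
Proof. by rewrite /downdate linearB linearZ /= trmx_mul trmxK M_sym. Qed.

Lemma mulmx_downdate (w : 'rV[F]_n) : w *m downdate = w *m M - (dot w u / dot t u) *: u.
Proof.
rewrite /downdate mulmxBr -scalemxAr mulmxA mulmx_tr_dot mul_scalar_mx scalerA.
by rewrite mulrC.
Qed.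

Lemma downdate_kermx : (kermx downdate :=: kermx M + t)%MS.
Proof.
apply/eqmxP/andP; split; last first.
  rewrite addsmx_sub; apply/andP; split; last first.
    by apply/sub_kermxP; rewrite mulmx_downdate tM divff // scale1r subrr.
  apply/rV_subP => w /sub_kermxP wM; apply/sub_kermxP.
  by rewrite mulmx_downdate wM -tM -dot_mulmx_sym // wM dot0l mul0r scale0r subr0.
apply/rV_subP => w /sub_kermxP; rewrite mulmx_downdate => /eqP.
rewrite subr_eq0 => /eqP wM.
rewrite -[w](subrK ((dot w u / dot t u) *: t)) addmx_sub_adds ?scalemx_sub //.
by apply/sub_kermxP; rewrite mulmxBl wM -scalemxAl tM subrr.
Qed.

Lemma mxrank_kermx_downdate : \rank (kermx downdate) = (\rank (kermx M)).+1.
Proof.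
have nu : u != 0 by apply: contraNneq ntu => ->; rewrite dotC dot0l.
have nt : t != 0 by apply: contraNneq nu => t0; rewrite -tM t0 mul0mx.
rewrite downdate_kermx mxrank_disjoint_sum ?rank_rV ?nt ?addn1 //.
apply/eqP; rewrite -submx0; apply/rV_subP => w.
rewrite sub_capmx => /andP[/sub_kermxP wM]; case/sub_rVP=> a Ew.
move: wM; rewrite {}Ew -scalemxAl tM => /eqP.
by rewrite scaler_eq0 (negPf nu) orbF => /eqP->; rewrite scale0r sub0mx.
Qed.

End Downdate.

Section Laplacian.
Variables (R : realFieldType) (n : nat) (g : rel 'I_n) (d : pred 'I_n).
Hypothesis g_sym : symmetric g.
Implicit Types w : 'rV[R]_n.

(* The Laplacian of [g], with a unit potential on [d]. *)
Definition laplacian : 'M[R]_n := \matrix_(k, l)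
  ((k == l)%:R * (\sum_m (g k m)%:R + (d k)%:R) - (g k l)%:R).

Lemma laplacian_sym : laplacian^T = laplacian.
Proof.
apply/matrixP => k l; rewrite !mxE g_sym eq_sym.
by case: eqVneq => [->|]; rewrite ?mul0r.
Qed.

Lemma laplacian_offdiag k l : k != l -> laplacian k l = - (g k l)%:R.
Proof. by move=> /negPf nkl; rewrite mxE nkl mul0r add0r. Qed.

Lemma laplacian_isolated i : (forall k, g i k = false) -> d i -> laplacian i i = 1.
Proof.
by move=> gi di; rewrite mxE gi eqxx di mul1r subr0 big1 ?add0r // => k _; rewrite gi.
Qed.

Lemma mul_laplacian w l :
  (w *m laplacian) 0 l = \sum_k (g k l)%:R * (w 0 l - w 0 k) + (d l)%:R * w 0 l.
Proof.
pose D k : R := \sum_m (g k m)%:R + (d k)%:R.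
have diag : \sum_k w 0 k * ((k == l)%:R * D k) = w 0 l * D l.
  rewrite (bigD1 l) //= eqxx mul1r big1 ?addr0 // => k /negPf->.
  by rewrite mul0r mulr0.
rewrite mxE; under eq_bigr do rewrite mxE mulrBr; rewrite sumrB diag mulrDr addrAC.
rewrite [(d l)%:R * _]mulrC; congr (_ + _).
under [in RHS]eq_bigr do rewrite mulrBr; rewrite sumrB; congr (_ - _).
  by rewrite mulrC big_distrl /=; apply: eq_bigr => k _; rewrite g_sym.
by apply: eq_bigr => k _; rewrite mulrC.
Qed.

Lemma dot_laplacian w : 2 * dot (w *m laplacian) w =
  \sum_l \sum_k (g k l)%:R * (w 0 l - w 0 k) ^+ 2 + 2 * \sum_l (d l)%:R * w 0 l ^+ 2.
Proof.
pose S := \sum_l \sum_k (g k l)%:R * (w 0 l - w 0 k) * w 0 l.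
have -> : dot (w *m laplacian) w = S + \sum_l (d l)%:R * w 0 l ^+ 2.
  rewrite dotE /S -big_split /=; apply: eq_bigr => l _.
  by rewrite mul_laplacian mulrDl big_distrl /= expr2 mulrA.
rewrite mulrDr; congr (_ + _).
rewrite mulr_natl mulr2n {2}/S exchange_big -big_split /=.
apply: eq_bigr => l _; rewrite -big_split /=; apply: eq_bigr => k _.
by rewrite [g l k]g_sym; ring.
Qed.

Lemma laplacian_form0 w : dot (w *m laplacian) w = 0 ->
  (forall k l, g k l -> w 0 k = w 0 l) /\ (forall l, d l -> w 0 l = 0).
Proof.
have q_ge0 k l : 0 <= (g k l)%:R * (w 0 l - w 0 k) ^+ 2 by rewrite mulr_ge0 ?sqr_ge0.
have d_ge0 l : 0 <= (d l)%:R * w 0 l ^+ 2 by rewrite mulr_ge0 ?sqr_ge0.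
move=> form0; have /esym/eqP := dot_laplacian w; rewrite form0 mulr0.
rewrite paddr_eq0 ?mulr_ge0 ?sumr_ge0 // => [|l _]; last exact: sumr_ge0.
rewrite mulf_eq0 pnatr_eq0 /= => /andP[/eqP Q0 /eqP D0]; split=> [k l gkl|l dl].
  have /(_ l isT) Ql := psumr_eq0P (fun l _ => sumr_ge0 _ (fun k _ => q_ge0 k l)) Q0.
  have /(_ k isT)/eqP := psumr_eq0P (fun k _ => q_ge0 k l) Ql.
  by rewrite gkl mul1r sqrf_eq0 subr_eq0 => /eqP.
have /(_ l isT)/eqP := psumr_eq0P (fun l _ => d_ge0 l) D0.
by rewrite dl mul1r sqrf_eq0 => /eqP.
Qed.

Lemma laplacian_kerP w : w *m laplacian = 0 <->
  (forall k l, g k l -> w 0 k = w 0 l) /\ (forall l, d l -> w 0 l = 0).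
Proof.
split=> [wL|[wg wd]]; first by apply: laplacian_form0; rewrite wL dot0l.
apply/rowP => l; rewrite mul_laplacian [RHS]mxE big1 ?add0r => [|k _].
  by case: (boolP (d l)) => [/wd->|_]; rewrite ?mulr0 ?mul0r.
by case: (boolP (g k l)) => [/wg->|_]; rewrite ?subrr ?mulr0 ?mul0r.
Qed.

Lemma laplacian_psd0 w : dot (w *m laplacian) w = 0 -> w *m laplacian = 0.
Proof. by move/laplacian_form0/laplacian_kerP. Qed.

End Laplacian.

Section ComponentLaplacian.
Variables (R : realFieldType) (n m : nat) (g : rel 'I_n) (s : 'I_m -> 'I_n).
Hypotheses (g_sym : symmetric g)
  (s_disj : forall a c, connect g (s a) (s c) = (a == c)).

Definition off_components : pred 'I_n := fun k => [forall a, ~~ connect g (s a) k].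

Definition component_laplacian : 'M[R]_n := laplacian R g off_components.

Definition component_mx : 'M[R]_(m, n) := \matrix_(a, k) (connect g (s a) k)%:R.

Lemma component_unique a c k : connect g (s a) k -> connect g (s c) k = (c == a).
Proof.
move=> cak; rewrite -s_disj; apply/idP/idP => [cck|]; last by move/connect_trans; apply.
by apply: connect_trans cck _; rewrite connectC.
Qed.

Lemma mul_component_mx (x : 'rV_m) a k :
  connect g (s a) k -> (x *m component_mx) 0 k = x 0 a.
Proof.
move=> cak; rewrite mxE (bigD1 a) //= mxE cak mulr1 big1 ?addr0 // => c /negPf nca.
by rewrite mxE (component_unique _ cak) nca mulr0.
Qed.

Lemma mul_component_mx_off (x : 'rV_m) k :
  off_components k -> (x *m component_mx) 0 k = 0.
Proof.
by move/forallP=> off_k; rewrite mxE big1 // => a _; rewrite mxE (negPf (off_k a)) mulr0.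
Qed.

Lemma row_free_component_mx : row_free component_mx.
Proof.
apply: inj_row_free => x x0; apply/rowP => a.
by rewrite -(mul_component_mx x (connect0 g (s a))) x0 !mxE.
Qed.

Lemma component_laplacian_sym : component_laplacian^T = component_laplacian.
Proof. exact: laplacian_sym. Qed.

Lemma component_kernel_coord (w : 'rV_n) :
  w *m component_laplacian = 0 -> w = (\row_a w 0 (s a)) *m component_mx.
Proof.
move=> /(laplacian_kerP _ g_sym)[wg wd]; apply/rowP => k.
have [off_k|] := boolP (off_components k); first by rewrite wd // mul_component_mx_off.
rewrite negb_forall => /existsP[a /negPn cak]; rewrite (mul_component_mx _ cak) mxE.
by apply: (connect_ind (P := fun l => w 0 l = w 0 (s a)) _ _ cak) => // l l' <- /wg.
Qed.

Lemma component_laplacian_kermx : (kermx component_laplacian :=: component_mx)%MS.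
Proof.
apply/eqmxP/andP; split; apply/rV_subP => w.
  by move/sub_kermxP/component_kernel_coord->; apply: submxMl.
case/submxP=> x ->; apply/sub_kermxP/laplacian_kerP => //; split=> [k l gkl|]; last first.
  exact: mul_component_mx_off.
rewrite !mxE; apply: eq_bigr => a _; rewrite !mxE; congr (_ * _%:R).
by rewrite (connect_edge_eq _ g_sym gkl).
Qed.

Lemma mxrank_component_laplacian_kermx : \rank (kermx component_laplacian) = m.
Proof. by rewrite component_laplacian_kermx; apply/eqP/row_free_component_mx. Qed.

End ComponentLaplacian.

(** * From an obstruction to the nullity pair (1,2) *)

(* [t] is the potential of a unit flow from [p] to [q] in the graph without the
   edge [pq]; giving this edge the negative of the effective conductance of the
   rest makes [t] a second kernel vector. *)
Section NonbridgeConstruction.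
Variables (R : realType) (n : nat) (G : sgraph 'I_n) (i p q : 'I_n).
Let e : rel 'I_n := @unrooted_adj (RGraph G i).
Let g : rel 'I_n := delete_edge e p q.
Hypotheses (epq : e p q) (cpq : connect g p q).

Let e_sym : symmetric e := @unrooted_sym (RGraph G i).
Let e_irr : irreflexive e := @unrooted_irr (RGraph G i).
Let g_sym : symmetric g := delete_edge_sym p q e_sym.
Let npq : p != q := edge_neq e_irr epq.
Let npi : p != i. Proof. by case/and3P: epq. Qed.
Let nqi : q != i. Proof. by case/and3P: epq. Qed.

Let s (_ : 'I_1) : 'I_n := p.
Let s_disj a c : connect g (s a) (s c) = (a == c).
Proof. by rewrite connect0 !ord1. Qed.

Let M : 'M[R]_n := component_laplacian R g s.
Let M_sym : M^T = M := component_laplacian_sym R s g_sym.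
Let u : 'rV[R]_n := delta_mx 0 p - delta_mx 0 q.

Let dot_u (w : 'rV_n) : dot w u = w 0 p - w 0 q.
Proof. by rewrite dotC dotDl -scaleN1r dotZl !dot_deltal mulN1r. Qed.

Let kerM_const (w : 'rV_n) k : w *m M = 0 -> connect g p k -> w 0 k = w 0 p.
Proof.
move/(component_kernel_coord g_sym s_disj) => -> cpk.
by rewrite !(mul_component_mx g_sym s_disj _ (a := ord0)) // connect0.
Qed.

Lemma unit_flow_potential : exists2 t : 'rV_n, t *m M = u & dot t u != 0.
Proof.
have [|t tM] := sym_mx_range (u := u) M_sym.
  by move=> w wM; rewrite dot_u (kerM_const wM cpq) subrr.
exists t => //; apply/eqP => tu; have : u = 0.
  by rewrite -tM; apply: (laplacian_psd0 g_sym); rewrite -/M tM dotC.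
by move/rowP/(_ p)/eqP; rewrite !mxE !eqxx (negPf npq) subr0 oner_eq0.
Qed.

Variable t : 'rV[R]_n.
Hypotheses (tM : t *m M = u) (ntu : dot t u != 0).
Let B : 'M[R]_n := downdate M t u.

Let u_i : u 0 i = 0.
Proof. by rewrite !mxE !(eq_sym i) (negPf npi) (negPf nqi) andbF subrr. Qed.

Let BE k l : B k l = M k l - (dot t u)^-1 * (u 0 k * u 0 l).
Proof. by rewrite /B /downdate !mxE big_ord1 !mxE. Qed.

Lemma flow_downdate_edge k l :
  k != i -> l != i -> k != l -> (B k l != 0) = e k l.
Proof.
move=> nki nli nkl; pose pq := (k == p) && (l == q) || (k == q) && (l == p).
have uu : u 0 k * u 0 l = - pq%:R.
  have kl0 r : (k == r)%:R * (l == r)%:R = 0 :> R.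
    by have [<-|_] := eqVneq k r; rewrite ?mul0r // eq_sym (negPf nkl) mulr0.
  rewrite !mxE /= mulrBl !mulrBr !kl0 subr0 sub0r -opprD; congr (- _).
  rewrite -!natrM -natrD !mulnb; congr _%:R; rewrite /pq.
  by have [->|_] := eqVneq k p; rewrite ?(negPf npq) //=; case: (l == q).
rewrite BE uu /M /component_laplacian laplacian_offdiag // /g /delete_edge -/pq.
have [/orP kl|_] := boolP pq; last first.
  by rewrite andbT oppr0 mulr0 subr0 oppr_eq0 natr_bool_neq0.
rewrite andbF oppr0 sub0r mulrN mulr1 opprK invr_eq0 ntu.
by case: kl => /andP[/eqP-> /eqP->]; rewrite // e_sym.
Qed.

Let kerB_split (w : 'rV_n) : w *m B = 0 -> exists a, (w - a *: t) *m M = 0.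
Proof.
rewrite mulmx_downdate => wB; exists (dot w u / dot t u).
by rewrite mulmxBl -scalemxAl tM.
Qed.

Lemma flow_downdate_determined (w : 'rV_n) :
  w *m B = 0 -> w 0 p = 0 -> w 0 q = 0 -> w = 0.
Proof.
move=> /kerB_split[a wM] wp wq.
have a0 : a = 0.
  have := kerM_const wM cpq; rewrite !mxE wp wq !sub0r => /oppr_inj/eqP.
  rewrite -subr_eq0 -mulrBr -opprB -dot_u mulf_eq0 oppr_eq0 (negPf ntu) orbF.
  exact: eqP.
move: wM; rewrite a0 scale0r subr0 => wM.
rewrite (component_kernel_coord g_sym s_disj wM); apply/rowP => k.
by rewrite !mxE big1 // => c _; rewrite !mxE wp mul0r.
Qed.

Lemma flow_downdate_kernel : (punctured_kermx i B :=: kermx B)%MS.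
Proof.
have gi k : g i k = false by rewrite /g /delete_edge /e unrooted_adjE eqxx.
have g_sub a b : g a b -> connect e a b by move/delete_edge_sub/connect1.
apply: punctured_kermx_isolated => [||k nki].
- exact: downdate_sym.
- rewrite BE u_i mul0r mulr0 subr0.
  rewrite /M /component_laplacian laplacian_isolated ?oner_eq0 //.
  by apply/forallP => c; apply/negP => /(connect_sub g_sub); rewrite connect_avoidF.
- rewrite BE u_i mul0r mulr0 subr0.
  by rewrite /M /component_laplacian laplacian_offdiag ?gi ?oppr0 // eq_sym.
Qed.

Lemma flow_downdate_strong_arnold : strong_arnold e (punctured_kermx i B).
Proof.
move=> X X_sym X0 XK; apply: (symmetric_mx_determined (P := pred2 p q)) X_sym XK _.
  move=> w; rewrite flow_downdate_kernel => /sub_kermxP wB w0.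
  by apply: flow_downdate_determined; rewrite // w0 //= eqxx ?orbT.
have eqp : e q p by rewrite e_sym.
by move=> k l /pred2P[]-> /pred2P[]->; apply: X0; rewrite ?eqxx ?epq ?eqp ?orbT.
Qed.

Lemma flow_downdate_allows : connected_graph G -> allows_with_SNIP R G i 1 2.
Proof.
move=> G_conn.
have [z [_ cpz zi]] := connect_last_edge (G_conn p i) npi.
have cgz : connect g p z.
  apply: connect_sub cpz => a b; rewrite -[avoid _ _ a b]/(e a b) => eab.
  have [gab|] := boolP (g a b); first exact: connect1.
  rewrite /g /delete_edge eab negbK => /orP[]/andP[/eqP-> /eqP->] //.
  by rewrite connectC.
apply: (allows_of_kernel (B := B) (v := row ord0 (component_mx R g s)) (j := z)).
- exact: downdate_sym.
- exact: flow_downdate_edge.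
- rewrite flow_downdate_kernel mxrank_kermx_downdate //.
  by rewrite mxrank_component_laplacian_kermx.
- exact: flow_downdate_strong_arnold.
- rewrite flow_downdate_kernel downdate_kermx // (submx_trans _ (addsmxSl _ _)) //.
  by rewrite component_laplacian_kermx // row_sub.
- by rewrite adj_sym.
- by rewrite !mxE cgz oner_eq0.
Qed.

End NonbridgeConstruction.

Lemma cyclic_allows (R : realType) n (G : sgraph 'I_n) (i : 'I_n) : connected_graph G ->
  cyclic (@unrooted_adj (RGraph G i)) -> allows_with_SNIP R G i 1 2.
Proof.
move=> G_conn /(cyclic_nonbridgeP (@unrooted_sym _) (@unrooted_irr _))[p [q [epq cpq]]].
have [t tM ntu] := unit_flow_potential R epq cpq.
exact: (flow_downdate_allows epq cpq tM ntu G_conn).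
Qed.

Lemma zero_diag_sym3_eq0 (R : realFieldType) (Y : 'I_3 -> 'I_3 -> R) (m : 'I_3 -> R) :
  (forall a c, Y a c = Y c a) -> (forall a, Y a a = 0) -> (forall a, m a != 0) ->
  (forall a, \sum_c Y a c * m c = 0) -> forall a c, Y a c = 0.
Proof.
move=> Y_sym Y_diag nm row_sum.
pose a0 : 'I_3 := ord0; pose a1 : 'I_3 := lift ord0 ord0; pose a2 : 'I_3 := ord_max.
have ord3 (a : 'I_3) : [\/ a = a0, a = a1 | a = a2].
  case: a => -[|[|[|//]]] lt_a; [apply: Or31 | apply: Or32 | apply: Or33];
    exact: val_inj.
have sumE a : \sum_c Y a c * m c = Y a a0 * m a0 + (Y a a1 * m a1 + Y a a2 * m a2).
  rewrite !big_ord_recl big_ord0 addr0; do 2!congr (_ + _).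
  by congr (Y a _ * m _); apply: val_inj.
have sum_row0 : Y a0 a1 * m a1 + Y a0 a2 * m a2 = 0.
  by have := row_sum a0; rewrite sumE Y_diag mul0r add0r.
have sum_row1 : Y a0 a1 * m a0 + Y a1 a2 * m a2 = 0.
  by have := row_sum a1; rewrite sumE Y_diag mul0r add0r [Y a1 a0]Y_sym.
have sum_row2 : Y a0 a2 * m a0 + Y a1 a2 * m a1 = 0.
  by have := row_sum a2; rewrite sumE Y_diag mul0r addr0 [Y a2 a0]Y_sym [Y a2 a1]Y_sym.
have cancel y a : y * m a = 0 -> y = 0.
  by move/eqP; rewrite mulf_eq0 (negPf (nm a)) orbF => /eqP.
have Y12 : Y a1 a2 = 0.
  apply: (cancel _ a1); apply: (cancel _ a2).
  have : (Y a0 a1 * m a0 + Y a1 a2 * m a2) * m a1 +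
         (Y a0 a2 * m a0 + Y a1 a2 * m a1) * m a2 -
         (Y a0 a1 * m a1 + Y a0 a2 * m a2) * m a0 = 2 * (Y a1 a2 * m a1 * m a2) by ring.
  by rewrite sum_row0 sum_row1 sum_row2 => ?; lra.
have Y01 : Y a0 a1 = 0 by apply: (cancel _ a0); move: sum_row1; rewrite Y12 mul0r addr0.
have Y02 : Y a0 a2 = 0 by apply: (cancel _ a0); move: sum_row2; rewrite Y12 mul0r addr0.
move=> a c; have [->|->|->] := ord3 a; have [->|->|->] := ord3 c;
  by rewrite ?Y_diag // Y_sym.
Qed.

(* Bordering at [b] leaves in the kernel the combinations of the indicators of the
   three legs whose weighted sum vanishes; this condition on each row forces a
   symmetric 3 x 3 array with zero diagonal to vanish. *)
Section BranchingConstruction.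
Variables (R : realType) (n : nat) (G : sgraph 'I_n) (i j b : 'I_n) (s : 'I_3 -> 'I_n).
Let e : rel 'I_n := @unrooted_adj (RGraph G i).
Let h : rel 'I_n := avoid e b.
Hypotheses (bs : forall a, e b (s a))
  (legs : forall a c, connect h (s a) (s c) = (a == c)).

Let e_sym : symmetric e := @unrooted_sym (RGraph G i).
Let e_irr : irreflexive e := @unrooted_irr (RGraph G i).
Let h_sym : symmetric h := induced_rel_sym (predC1 b) e_sym.
Let nbi : b != i. Proof. by case/and3P: (bs ord0). Qed.
Let nsi a : s a != i. Proof. by case/and3P: (bs a). Qed.
Let nsb a : s a != b. Proof. by rewrite eq_sym (edge_neq e_irr (bs a)). Qed.

Let M : 'M[R]_n := component_laplacian R h s.
Let legs_mx : 'M[R]_(3, n) := component_mx R h s.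
Let beta : 'rV[R]_n := \row_k (e b k)%:R.
Let B : 'M[R]_n := border b beta M.
Let weight a : R := dot (row a legs_mx) beta.

Let M_sym : M^T = M := component_laplacian_sym R s h_sym.
Let B_sym : B^T = B := border_sym b beta M_sym.

Let weight_gt0 a : 0 < weight a.
Proof.
rewrite /weight dotE (bigD1 (s a)) //= !mxE connect0 bs mulr1 ltr_pwDl ?ltr01 //.
by apply: sumr_ge0 => k _; rewrite !mxE mulr_ge0.
Qed.

Let weight_neq0 a : weight a != 0. Proof. by rewrite gt_eqF ?weight_gt0. Qed.

Let dot_legs (x : 'rV_3) : dot (x *m legs_mx) beta = \sum_a x 0 a * weight a.
Proof.
rewrite /dot -mulmxA mxE; apply: eq_bigr => a _; congr (_ * _).
by rewrite /weight /dot -row_mul [RHS]mxE.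
Qed.

Lemma leg_avoids_center a : connect h (s a) b = false.
Proof. exact: connect_avoidF. Qed.

Lemma leg_avoids_root a : connect h (s a) i = false.
Proof. by apply/negP => /connect_induced_sub; rewrite connect_avoidF. Qed.

Let off_b : off_components h s b.
Proof. by apply/forallP => a; rewrite leg_avoids_center. Qed.

Let off_i : off_components h s i.
Proof. by apply/forallP => a; rewrite leg_avoids_root. Qed.

Let punctured_M : (punctured_kermx b M :=: legs_mx)%MS.
Proof.
apply: eqmx_trans (component_laplacian_kermx R h_sym legs).
have hb k : h b k = false by rewrite /h avoidE eqxx.
apply: punctured_kermx_isolated => // [|k nkb].
  by rewrite /M /component_laplacian laplacian_isolated ?oner_eq0.
by rewrite /M /component_laplacian laplacian_offdiag ?hb ?oppr0 // eq_sym.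
Qed.

Let leg_kernel : (row ord0 legs_mx <= punctured_kermx b M)%MS.
Proof. by rewrite punctured_M row_sub. Qed.

Lemma branching_kernel (w : 'rV_n) :
  (w <= kermx B)%MS = (w <= legs_mx)%MS && (dot w beta == 0).
Proof.
by rewrite (sub_kermx_border w M_sym leg_kernel (weight_neq0 ord0)) punctured_M.
Qed.

Lemma mxrank_branching_kernel : \rank (kermx B) = 2%N.
Proof.
have parter : parter_vertex b B := parter_border leg_kernel (weight_neq0 ord0).
have := (parterP b B_sym).1 parter; rewrite punctured_kermx_border punctured_M.
by rewrite (eqP (row_free_component_mx R h_sym legs)) => -[].
Qed.

Lemma branching_kernel_root : (punctured_kermx i B :=: kermx B)%MS.
Proof.
have hi k : h i k = false by rewrite /h avoidE /e unrooted_adjE eqxx !andbF.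
have ebi : e b i = false by rewrite e_sym /e unrooted_adjE eqxx.
apply: punctured_kermx_isolated => // [|k nki]; rewrite mxE [i == b]eq_sym (negPf nbi).
  by rewrite /M /component_laplacian laplacian_isolated ?oner_eq0.
have [_|_] := eqVneq k b; first by rewrite mxE ebi.
by rewrite /M /component_laplacian laplacian_offdiag ?hi ?oppr0 // eq_sym.
Qed.

Lemma branching_edge k l : k != i -> l != i -> k != l -> (B k l != 0) = e k l.
Proof.
move=> nki nli nkl; rewrite mxE.
have [->|nkb] := eqVneq k b; first by rewrite mxE natr_bool_neq0.
have [->|nlb] := eqVneq l b; first by rewrite mxE natr_bool_neq0 e_sym.
rewrite /M /component_laplacian laplacian_offdiag // oppr_eq0 natr_bool_neq0.
by rewrite /h avoidE nkb nlb.
Qed.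

Let leg_coord (w : 'rV_n) : (w <= legs_mx)%MS -> w = (\row_a w 0 (s a)) *m legs_mx.
Proof.
rewrite -(component_laplacian_kermx R h_sym legs) => /sub_kermxP.
exact: component_kernel_coord.
Qed.

Lemma branching_strong_arnold : strong_arnold e (punctured_kermx i B).
Proof.
move=> X X_sym X0; rewrite branching_kernel_root => XK.
have rowK k : (row k X <= legs_mx)%MS && (dot (row k X) beta == 0).
  by rewrite -branching_kernel (submx_trans (row_sub k X)).
have Y0 : forall a c, X (s a) (s c) = 0.
  apply: (zero_diag_sym3_eq0 (m := weight)) => // [a c|a|a].
  - by rewrite -{1}X_sym mxE.
  - by rewrite X0 ?eqxx.
  have /andP[/leg_coord Ew /eqP] := rowK (s a); rewrite Ew dot_legs => sum0.
  by rewrite -[RHS]sum0; apply: eq_bigr => c _; rewrite !mxE.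
apply: (symmetric_mx_determined (P := [pred k | [exists a, s a == k]])) X_sym XK _.
  move=> w; rewrite branching_kernel => /andP[/leg_coord Ew _] w0.
  rewrite Ew; apply/rowP => k.
  rewrite !mxE big1 // => a _; rewrite mxE w0 ?mul0r //.
  by apply/existsP; exists a.
by move=> k l /existsP[a /eqP<-] /existsP[c /eqP<-].
Qed.

Hypotheses (ij : adj G i j) (csj : connect h (s ord0) j).

Lemma branching_border_allows : allows_with_SNIP R G i 1 2.
Proof.
pose a1 : 'I_3 := lift ord0 ord0.
pose v := weight a1 *: row ord0 legs_mx - weight ord0 *: row a1 legs_mx.
apply: (allows_of_kernel (B := B) (v := v) (j := j)) => //.
- exact: branching_edge.
- by rewrite branching_kernel_root mxrank_branching_kernel.
- exact: branching_strong_arnold.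
- rewrite branching_kernel_root branching_kernel.
  rewrite addmx_sub ?eqmx_opp ?scalemx_sub ?row_sub //=.
  by rewrite dotDl -scaleN1r !dotZl -!/(weight _) mulN1r mulrC subrr.
- by rewrite !mxE csj (component_unique h_sym legs _ csj) mulr0 subr0 mulr1.
Qed.

End BranchingConstruction.

Lemma branching_allows (R : realType) n (G : sgraph 'I_n) (i : 'I_n) (H := RGraph G i) :
  ~ cyclic (@unrooted_adj H) -> branching H -> allows_with_SNIP R G i 1 2.
Proof.
move=> acyclic /(branching_legs acyclic)[j [b [s [ij csj bs legs]]]].
exact: branching_border_allows bs legs ij csj.
Qed.

Lemma obstructed_allows (R : realType) n (G : sgraph 'I_n) (i : 'I_n) :
  connected_graph G -> obstructed (RGraph G i) -> allows_with_SNIP R G i 1 2.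
Proof.
move=> G_conn; have [cyc _|acyclic] := pselect (cyclic (@unrooted_adj (RGraph G i))).
  exact: cyclic_allows.
by case=> [//|]; apply: branching_allows.
Qed.

Theorem theorem5p8 (R : realType) (n : nat) (G : sgraph 'I_n) (i : 'I_n)
    (hG : connected_graph G) :
  (allows_with_SNIP R G i 1 2 <->
     (rooted_minor Paw (RGraph G i) \/ rooted_minor S211 (RGraph G i))) /\
  ((rooted_minor Paw (RGraph G i) \/ rooted_minor S211 (RGraph G i)) <->
     ~ yam_graph (RGraph G i)).
Proof.
have minorP : rooted_minor Paw (RGraph G i) \/ rooted_minor S211 (RGraph G i) <->
    obstructed (RGraph G i).
  split; last exact: obstructed_minor.
  by case; apply: minor_obstructed; [apply: Paw_obstructed | apply: S211_obstructed].
have allowsP : allows_with_SNIP R G i 1 2 <-> obstructed (RGraph G i).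
  by split; [apply: allows_obstructed | apply: obstructed_allows].
split; first exact: (iff_trans allowsP (iff_sym minorP)).
apply: (iff_trans minorP); rewrite (yam_graphP (H := RGraph G i) hG).
by split=> [obs nobs //|]; apply: contrapT.
Qed.
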